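(* Let $(X,\xi)$ be a weak $\omega$-category, let $k(X)\subseteq X$ be the globular subset of all hereditarily invertible cells of $X$, let $n\in\mathbb{N}$, and let $(\phi,\boldsymbol{u})\in\bigl(L\bigl(k(X)\bigr)\bigr)_n\subseteq (LX)_n$. Then $\xi(\phi,\boldsymbol{u})\in k(X)_n$. Therefore $k(X)$ is also a weak $\omega$-category, which is a weak $\omega$-subcategory of $X$ (i.e., a subobject of $X$ in the category of weak $\omega$-categories and strict $\omega$-functors).
   Context: **Globular sets.** A globular set $X$ consists of sets $X_n$ ($n\ge 0$), whose elements are called $n$-cells, and maps $s^X_n,t^X_n\colon X_{n+1}\to X_n$ with $s_n^Xs_{n+1}^X=s_n^Xt_{n+1}^X$ and $t_n^Xs_{n+1}^X=t_n^Xt_{n+1}^X$ (equivalently, a presheaf on the globe category). Morphisms commute with all $s,t$; the category is $\mathbf{GSet}$. For $m<n$, $s^X_m,t^X_m\colon X_n\to X_m$ denote the iterated source and target maps. Two $n$-cells are parallel if $n=0$, or $n\ge 1$ and they have the same $s^X_{n-1}$ and the same $t^X_{n-1}$. For $n\ge1$ and an $n$-cell $u$, $u\colon x\to y$ means $s^X_{n-1}(u)=x$, $t^X_{n-1}(u)=y$. $G^n$ is the representable globular set, so morphisms $G^n\to X$ correspond to $n$-cells of $X$; $\iota_n\colon\partial G^n\to G^n$ is the inclusion of the largest proper globular subset. For $n\ge 1$, morphisms $\partial G^n\to X$ correspond to parallel pairs $(u,v)$ of $(n-1)$-cells; the corresponding morphism is written $\langle u,v\rangle$. $1$ is the terminal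 globular set. **The monad $T$.** $T=(T,\eta^T,\mu^T)$ is the monad on $\mathbf{GSet}$ induced by the monadic forgetful functor from small strict $\omega$-categories and strict $\omega$-functors. It is described as follows. A pasting scheme of rank $r\ge0$ is a table of non-negative integers $\boldsymbol{k}=\begin{bmatrix}k_0&&k_1&&\dots&&k_r\\&\underline{k}_1&&\underline{k}_2&\dots&\underline{k}_r&\end{bmatrix}$ with $k_{i-1}>\underline k_i<k_i$ for $1\le i\le r$; it is of dimension $n$ if $k_i\le n$ for all $i$. A pasting diagram of shape $\boldsymbol k$ in $X$ is a table $\boldsymbol{u}=\begin{bmatrix}u_0&&u_1&&\dots&&u_r\\&\underline{u}_1&&\underline{u}_2&\dots&\underline{u}_r&\end{bmatrix}$ with $u_i\in X_{k_i}$, $\underline u_i\in X_{\underline k_i}$ and $t^X_{\underline k_i}(u_{i-1})=\underline u_i=s^X_{\underline k_i}(u_i)$ for $1\le i\le r$. Then $(TX)_n$ is the set of pasting diagrams in $X$ of dimension $n$ (i.e. whose shape is of dimension $n$); in particular $(T1)_n$ is the set of pasting schemes of dimension $n$, $T!\colon TX\to T1$ sends a diagram to its shape, and $Tf$ applies $f$ entrywise. When a scheme or diagram is regarded as an $n$-cell we may write a superscript $(n)$. An $n$-cell $\boldsymbol k$ of $T1$ is degenerate if $\max_i k_i<n$. For $m<n$, an $m$-transversal component of $\boldsymbol k$ is given by indices $0\le i\le j\le r$ such that $k_l>m$ for $i\le l\le j$, $\underline k_l\ge m$ for $i+1\le l\le j$, either $i=0$ or $\underline k_i<m$, and either $j=r$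 or $\underline k_{j+1}<m$. $s^{TX}_m(\boldsymbol u)$ (resp. $t^{TX}_m(\boldsymbol u)$) is obtained from $\boldsymbol u$ by replacing, for each $m$-transversal component $i\le j$, the segment $u_i,\underline u_{i+1},\dots,\underline u_j,u_j$ by the single top-row entry $s^X_m(u_i)$ (resp. $t^X_m(u_j)$). The unit sends $x\in X_n$ to the one-entry diagram $[x]$ (so $\eta^T_1$ picks out $[n]\in(T1)_n$), and $\mu^T_X$ glues a pasting diagram of pasting diagrams together. **Weak $\omega$-categories (Leinster).** $T$ is a cartesian monad. A cartesian monad over $T$ with contraction is a monad $P$ on $\mathbf{GSet}$ with a monad morphism $\mathrm{ar}^P\colon P\to T$ all of whose naturality squares are pullbacks, together with a function $\kappa^P$ assigning to each $n\ge1$, $u\colon\partial G^n\to P1$, $v\colon G^n\to T1$ with $\mathrm{ar}^P_1\circ u=v\circ\iota_n$ a morphism $\kappa^P(u,v)\colon G^n\to P1$ with $\kappa^P(u,v)\circ\iota_n=u$ and $\mathrm{ar}^P_1\circ\kappa^P(u,v)=v$. Morphisms are monad morphisms $\alpha\colon P\to Q$ with $\mathrm{ar}^Q\circ\alpha=\mathrm{ar}^P$ and $\alpha_1\circ\kappa^P(u,v)=\kappa^Q(\alpha_1\circ u,v)$. This category has an initial object $(L,\mathrm{ar}^L,\kappa^L)$; write $\mathrm{ar}_X=\mathrm{ar}^L_X$, $\mathrm{ar}=\mathrm{ar}^L_1\colon L1\to T1$, $\kappa=\kappa^L$. A weak $\omega$-category is an Eilenberg–Moore algebra $(X,\xi\colon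 LX\to X)$ of the monad $L$; a strict $\omega$-functor is a morphism of $L$-algebras. Since $LX$ is the pullback of $T!\colon TX\to T1$ and $\mathrm{ar}$, an $n$-cell of $LX$ is a pair $(\phi,\boldsymbol u)$ with $\phi\in(L1)_n$ and $\boldsymbol u\in(TX)_n$ of shape $\mathrm{ar}(\phi)$, with sources and targets taken componentwise. For parallel $\phi,\phi'\in(L1)_{n-1}$ and $\boldsymbol k\in(T1)_n$ with $\mathrm{ar}(\phi)=s^{T1}_{n-1}(\boldsymbol k)=t^{T1}_{n-1}(\boldsymbol k)=\mathrm{ar}(\phi')$, $\kappa(\langle\phi,\phi'\rangle,\boldsymbol k)\in(L1)_n$ is a cell $\phi\to\phi'$ of arity $\boldsymbol k$. **Identities and composition.** Let $\widetilde e_n\in(L1)_n$ be the image under $\eta^L_1$ of the unique $n$-cell of $1$. The standard pasting instruction $\mathrm{sp}(\boldsymbol k)\in(L1)_n$ of $\boldsymbol k\in(T1)_n$ is defined inductively on $n$: $\mathrm{sp}([n])=\widetilde e_n$, and otherwise $\mathrm{sp}(\boldsymbol k)=\kappa(\langle\mathrm{sp}(\boldsymbol k'),\mathrm{sp}(\boldsymbol k')\rangle,\boldsymbol k)$ where $\boldsymbol k'=s^{T1}_{n-1}(\boldsymbol k)=t^{T1}_{n-1}(\boldsymbol k)$. In a weak $\omega$-category $(X,\xi)$ and for $n\ge1$: for $x\in X_{n-1}$ put $\mathrm{id}_n(x)=\xi(\mathrm{sp}([n-1]^{(n)}),[x])$, an $n$-cell $x\to x$; for $n$-cells $u\colon x\to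 y$, $v\colon y\to z$ put $u\ast_{n-1}v=\xi\Bigl(\mathrm{sp}\Bigl(\begin{bmatrix}n&&n\\&n-1&\end{bmatrix}\Bigr),\begin{bmatrix}u&&v\\&y&\end{bmatrix}\Bigr)$, an $n$-cell $x\to z$. **Invertible cells.** Invertible means weakly invertible, defined coinductively. For $S\subseteq\coprod_nX_n$ let $\Phi^X(S)$ be the set of all cells $u\colon x\to y$ of dimension $n\ge1$ for which there exist an $n$-cell $v\colon y\to x$ and $(n+1)$-cells $p\colon u\ast_{n-1}v\to\mathrm{id}_n(x)$ and $q\colon v\ast_{n-1}u\to\mathrm{id}_n(y)$ in $S$. The set of invertible cells of $X$ is the greatest fixed point (equivalently, the greatest $W$ with $W\subseteq\Phi^X(W)$) of the monotone map $\Phi^X$. An inverse of an $n$-cell $u\colon x\to y$ is an $n$-cell $v\colon y\to x$ for which there are invertible $(n+1)$-cells $u\ast_{n-1}v\to\mathrm{id}_n(x)$ and $v\ast_{n-1}u\to\mathrm{id}_n(y)$. For $n$-cells $x,y$ ($n\ge0$), $x\sim y$ means that there is an invertible $(n+1)$-cell $x\to y$. **Hereditarily invertible cells.** An $n$-cell $x$ of a weak $\omega$-category $X$ is hereditarily invertible if either $n=0$, or $n\ge1$, $x$ is invertible, and $s^X_{n-1}(x)$ and $t^X_{n-1}(x)$ are hereditarily invertible. These cells are closed under sources and targets and so form a globular subset $k(X)$ of $X$. Since $L$ preserves pullbacks, it preserves monomorphisms, so $L(k(X))$ is regarded as a globular subset of $LX$ (namely the pairs $(\phi,\boldsymbol u)$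 with all entries of $\boldsymbol u$ in $k(X)$). *)

(* Defs.v *)
From mathcomp Require Import all_boot boolp zify.

Set Implicit Arguments.
Unset Strict Implicit.
Unset Printing Implicit Defensive.

Record globular_set := GlobularSet {
  cells :> nat -> Type;
  src : forall n, cells n.+1 -> cells n;
  tgt : forall n, cells n.+1 -> cells n;
  src_tgt : forall n (x : cells n.+2), src (src x) = src (tgt x);
  tgt_src : forall n (x : cells n.+2), tgt (src x) = tgt (tgt x) }.

Arguments src {g n} _.
Arguments tgt {g n} _.

Record gmap (X Y : globular_set) := Gmap {
  gfun :> forall n, X n -> Y n;
  gmap_src : forall n (x : X n.+1), gfun (src x) = src (gfun x);
  gmap_tgt : forall n (x : X n.+1), gfun (tgt x) = tgt (gfun x) }.

Arguments gfun {X Y} _ n _.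

Definition gid (X : globular_set) : gmap X X :=
  @Gmap X X (fun _ x => x) (fun _ _ => erefl) (fun _ _ => erefl).

Lemma gcomp_src X Y Z (g : gmap Y Z) (f : gmap X Y) n (x : X n.+1) :
  g n (f n (src x)) = src (g n.+1 (f n.+1 x)).
Proof. by rewrite !gmap_src. Qed.

Lemma gcomp_tgt X Y Z (g : gmap Y Z) (f : gmap X Y) n (x : X n.+1) :
  g n (f n (tgt x)) = tgt (g n.+1 (f n.+1 x)).
Proof. by rewrite !gmap_tgt. Qed.

Definition gcomp X Y Z (g : gmap Y Z) (f : gmap X Y) : gmap X Z :=
  @Gmap X Z (fun n x => g n (f n x)) (gcomp_src g f) (gcomp_tgt g f).

Definition gone : globular_set :=
  @GlobularSet (fun _ => unit) (fun _ _ => tt) (fun _ _ => tt)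
    (fun _ _ => erefl) (fun _ _ => erefl).

Definition gbang (X : globular_set) : gmap X gone :=
  @Gmap X gone (fun _ _ => tt) (fun _ _ => erefl) (fun _ _ => erefl).

(* Here and below, constructions on cells of positive dimension are indexed by
   the dimension minus one. *)
Definition parallel (X : globular_set) n : X n -> X n -> Prop :=
  match n with
  | 0 => fun _ _ => True
  | m.+1 => fun x y => src x = src y /\ tgt x = tgt y
  end.

Definition is_pullback (A B C D : globular_set)
    (p : gmap A B) (q : gmap A C) (f : gmap B D) (g : gmap C D) : Prop :=
  (forall n a, f n (p n a) = g n (q n a)) /\
  (forall (Z : globular_set) (h : gmap Z B) (k : gmap Z C),
     (forall n z, f n (h n z) = g n (k n z)) ->
     exists l : gmap Z A,
       ((forall n z, p n (l n z) = h n z) /\ (forall n z, q n (l n z) = k n z))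
       /\ forall l' : gmap Z A,
            (forall n z, p n (l' n z) = h n z) ->
            (forall n z, q n (l' n z) = k n z) ->
            forall n z, l' n z = l n z).

Definition cell (X : globular_set) := {n : nat & X n}.
Definition Cell (X : globular_set) n (x : X n) : cell X := existT _ n x.
Definition dim (X : globular_set) (c : cell X) : nat := projT1 c.

Definition cell_src (X : globular_set) (c : cell X) : cell X :=
  match c with
  | existT n x => match n return X n -> cell X with
                  | 0 => fun x => Cell x
                  | m.+1 => fun x => Cell (src x)
                  end x
  end.

Definition cell_tgt (X : globular_set) (c : cell X) : cell X :=
  match c with
  | existT n x => match n return X n -> cell X with
                  | 0 => fun x => Cell x
                  | m.+1 => fun x => Cell (tgt x)
                  end x
  end.

(* Iterated source and target; a cell of dimension at most m is left unchanged. *)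
Definition csrc X m (c : cell X) : cell X := iter (dim c - m) (@cell_src X) c.
Definition ctgt X m (c : cell X) : cell X := iter (dim c - m) (@cell_tgt X) c.

Section CellLemmas.
Variable X : globular_set.
Implicit Types c : cell X.

Lemma dim_iter_src k c : dim (iter k (@cell_src X) c) = dim c - k.
Proof.
elim: k => [|k IH] /=; first by rewrite subn0.
by rewrite subnS -IH; case: (iter _ _ _) => [[|n] x].
Qed.

Lemma dim_iter_tgt k c : dim (iter k (@cell_tgt X) c) = dim c - k.
Proof.
elim: k => [|k IH] /=; first by rewrite subn0.
by rewrite subnS -IH; case: (iter _ _ _) => [[|n] x].
Qed.

Lemma dim_csrc m c : dim (csrc m c) = minn m (dim c).
Proof. by rewrite /csrc dim_iter_src minnC minnE. Qed.

Lemma dim_ctgt m c : dim (ctgt m c) = minn m (dim c).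
Proof. by rewrite /ctgt dim_iter_tgt minnC minnE. Qed.

Lemma csrc_id m c : dim c <= m -> csrc m c = c.
Proof. by rewrite /csrc -subn_eq0 => /eqP ->. Qed.

Lemma ctgt_id m c : dim c <= m -> ctgt m c = c.
Proof. by rewrite /ctgt -subn_eq0 => /eqP ->. Qed.

Lemma cell_src_tgt c : 1 < dim c -> cell_src (cell_tgt c) = cell_src (cell_src c).
Proof. by case: c => [[|[|n]] x] //= _; rewrite src_tgt. Qed.

Lemma cell_tgt_src c : 1 < dim c -> cell_tgt (cell_src c) = cell_tgt (cell_tgt c).
Proof. by case: c => [[|[|n]] x] //= _; rewrite tgt_src. Qed.

Lemma iter_src_tgt k j c : 0 < k -> k + j <= dim c ->
  iter k (@cell_src X) (iter j (@cell_tgt X) c) = iter (k + j) (@cell_src X) c.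
Proof.
case: k => // k _; elim: j k => [|j IH] k le_kj; first by rewrite addn0.
rewrite iterSr iterS cell_src_tgt; last by rewrite dim_iter_tgt; lia.
rewrite -iterSr -iterSr IH //; last by lia.
by rewrite addnS.
Qed.

Lemma iter_tgt_src k j c : 0 < k -> k + j <= dim c ->
  iter k (@cell_tgt X) (iter j (@cell_src X) c) = iter (k + j) (@cell_tgt X) c.
Proof.
case: k => // k _; elim: j k => [|j IH] k le_kj; first by rewrite addn0.
rewrite iterSr iterS cell_tgt_src; last by rewrite dim_iter_src; lia.
rewrite -iterSr -iterSr IH //; last by lia.
by rewrite addnS.
Qed.

Lemma csrc_csrc p m c : p <= m -> csrc p (csrc m c) = csrc p c.
Proof.
move=> le_pm; rewrite {1}/csrc dim_csrc /csrc -iterD; congr iter; lia.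
Qed.

Lemma ctgt_ctgt p m c : p <= m -> ctgt p (ctgt m c) = ctgt p c.
Proof.
move=> le_pm; rewrite {1}/ctgt dim_ctgt /ctgt -iterD; congr iter; lia.
Qed.

Lemma csrc_ctgt p m c : p < m -> csrc p (ctgt m c) = csrc p c.
Proof.
move=> lt_pm; have [le_cm|lt_mc] := leqP (dim c) m; first by rewrite ctgt_id.
rewrite {1}/csrc dim_ctgt /ctgt iter_src_tgt /csrc; [congr iter| |]; lia.
Qed.

Lemma ctgt_csrc p m c : p < m -> ctgt p (csrc m c) = ctgt p c.
Proof.
move=> lt_pm; have [le_cm|lt_mc] := leqP (dim c) m; first by rewrite csrc_id.
rewrite {1}/ctgt dim_csrc /csrc iter_tgt_src /ctgt; [congr iter| |]; lia.
Qed.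

Lemma csrc_Cell n (x : X n.+1) : csrc n (Cell x) = Cell (src x).
Proof. by rewrite /csrc /= subSnn. Qed.

Lemma ctgt_Cell n (x : X n.+1) : ctgt n (Cell x) = Cell (tgt x).
Proof. by rewrite /ctgt /= subSnn. Qed.

End CellLemmas.

(* The table with top row u_0, ..., u_r and bottom row v_1, ..., v_r is encoded
   as (u_0, [:: (v_1, u_1); ...; (v_r, u_r)]). *)
Definition table X : Type := (cell X * seq (cell X * cell X))%type.

Fixpoint linked X (u : cell X) (us : seq (cell X * cell X)) : Prop :=
  match us with
  | [::] => True
  | (a, v) :: us' =>
      [/\ dim a < dim u, dim a < dim v, ctgt (dim a) u = a,
          csrc (dim a) v = a & linked v us']
  end.

Definition dim_le X n (U : table X) : bool :=
  (dim U.1 <= n) && all (fun p => dim p.2 <= n) U.2.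

(* Pasting diagrams of dimension n in X; the bottom entries have
   dimension < n by linkedness. *)
Record pasting X n := Pasting {
  tab : table X;
  tab_linked : linked tab.1 tab.2;
  tab_dim : dim_le n tab }.

Lemma pasting_inj X n (U V : pasting X n) : tab U = tab V -> U = V.
Proof.
case: U V => [u lu du] [v lv dv] /= e; subst v.
by rewrite (Prop_irrelevance lu lv) (Prop_irrelevance du dv).
Qed.

(* Cuts the table (u, us) at the bottom entries of dimension < m; the result is
   the first block and the list of remaining blocks, each preceded by the
   bottom entry at which the cut was made. In a linked table, the blocks
   with first entry of dimension > m are exactly the m-transversal components,
   and every other block consists of a single entry of dimension <= m. *)
Fixpoint blocks X m (u : cell X) (us : seq (cell X * cell X)) :
    table X * seq (cell X * table X) :=
  match us with
  | [::] => ((u, [::]), [::])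
  | (a, v) :: us' =>
      let BB := blocks m v us' in
      if dim a < m then ((u, [::]), (a, BB.1) :: BB.2)
      else ((u, (a, BB.1.1) :: BB.1.2), BB.2)
  end.

Definition join X (BB : table X * seq (cell X * table X)) : table X :=
  (BB.1.1, BB.1.2 ++ flatten [seq (p.1, p.2.1) :: p.2.2 | p <- BB.2]).

Definition last_entry X (B : table X) : cell X := last B.1 (unzip2 B.2).

Definition table_src X m (U : table X) : table X :=
  let BB := blocks m U.1 U.2 in
  (csrc m BB.1.1, [seq (p.1, csrc m p.2.1) | p <- BB.2]).

Definition table_tgt X m (U : table X) : table X :=
  let BB := blocks m U.1 U.2 in
  (ctgt m (last_entry BB.1), [seq (p.1, ctgt m (last_entry p.2)) | p <- BB.2]).

Section TableLemmas.
Variable X : globular_set.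
Implicit Types (u v a : cell X) (us vs : seq (cell X * cell X)) (U V B C : table X).

Lemma blocks_head m u us : (blocks m u us).1.1 = u.
Proof. by case: us => [|[a v] us] //=; case: ifP. Qed.

Lemma table_srcE m u us : table_src m (u, us) =
  (csrc m u, [seq (p.1, csrc m p.2) | p <- us & dim p.1 < m]).
Proof.
rewrite /table_src /= blocks_head; congr pair.
elim: us u => [|[a v] us IH] u //=.
by case: ifP => _ /=; rewrite -(IH v) // blocks_head.
Qed.

Lemma table_tgt_cons m u a v us : table_tgt m (u, (a, v) :: us) =
  if dim a < m then (ctgt m u, (a, (table_tgt m (v, us)).1) :: (table_tgt m (v, us)).2)
  else table_tgt m (v, us).
Proof. by rewrite /table_tgt /=; case: ifP. Qed.

Lemma table_src_src p m U : p <= m -> table_src p (table_src m U) = table_src p U.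
Proof.
case: U => u us le_pm; rewrite !table_srcE csrc_csrc //; congr pair.
elim: us => [|[a v] us IH] //=.
case: (ltnP (dim a) m) => [lt_am|le_ma] /=; last by rewrite IH ltnNge (leq_trans le_pm).
by case: ifP => _ //=; rewrite IH csrc_csrc.
Qed.

Lemma table_src_tgt p m U : p < m -> linked U.1 U.2 ->
  table_src p (table_tgt m U) = table_src p U.
Proof.
case: U => u us lt_pm /=; elim: us u => [|[a v] us IH] u /=.
  by rewrite /table_tgt /table_src /= csrc_ctgt.
move=> [lt_au lt_av tu sv] /IH; rewrite table_tgt_cons.
case: (ltnP (dim a) m) => [lt_am|le_ma].
  case: (table_tgt m (v, us)) => w ws; rewrite !table_srcE /= csrc_ctgt //.
  by case=> e1 e2; case: ifP => _ /=; rewrite ?e1 e2.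
move=> ->; rewrite !table_srcE /=.
have lt_pa : p < dim a by apply: leq_trans le_ma.
by rewrite ltnNge ltnW //= -(csrc_csrc v (ltnW lt_pa)) sv -tu csrc_ctgt.
Qed.

Lemma table_tgt_tgt p m U : p <= m -> table_tgt p (table_tgt m U) = table_tgt p U.
Proof.
case: U => u us le_pm; elim: us u => [|[a v] us IH] u /=.
  by rewrite /table_tgt /= /last_entry /= ctgt_ctgt.
rewrite !table_tgt_cons; case: (ltnP (dim a) m) => [lt_am|le_ma].
  rewrite table_tgt_cons -surjective_pairing IH ctgt_ctgt //.
by rewrite ltnNge (leq_trans le_pm le_ma).
Qed.

Lemma table_tgt_src p m U : p < m -> linked U.1 U.2 ->
  table_tgt p (table_src m U) = table_tgt p U.
Proof.
case: U => u us lt_pm /=; elim: us u => [|[a v] us IH] u /=.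
  by rewrite /table_tgt /table_src /= /last_entry /= ctgt_csrc.
move=> [lt_au lt_av tu sv] /IH; rewrite !table_srcE /=.
case: (ltnP (dim a) m) => [lt_am|le_ma] /=.
  by move=> IHv; rewrite !table_tgt_cons IHv ctgt_csrc.
rewrite table_tgt_cons ltnNge.
have lt_pa : p < dim a by apply: leq_trans le_ma.
rewrite (ltnW lt_pa) /= => <-.
have e : ctgt p u = ctgt p v.
  by rewrite -(ctgt_ctgt u (ltnW lt_pa)) tu -sv ctgt_csrc.
case: [seq _ | _ <- _] => [|[b w] ws]; first by rewrite /table_tgt /= /last_entry /= !ctgt_csrc ?e.
by rewrite !table_tgt_cons !ctgt_csrc // e.
Qed.

Lemma head_tgt p u us : linked u us ->
  minn p (dim (table_tgt p (u, us)).1) = minn p (dim u).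
Proof.
elim: us u => [|[a v] us IH] u.
  by rewrite /table_tgt /= /last_entry /= dim_ctgt; lia.
rewrite table_tgt_cons => -[lt_au lt_av tu sv] /IH.
by case: ifP => [_ _|]; rewrite /= ?dim_ctgt; lia.
Qed.

Lemma dim_head_tgt p u us : linked u us -> dim (table_tgt p (u, us)).1 <= p.
Proof.
elim: us u => [|[a v] us IH] u.
  by rewrite /table_tgt /= /last_entry /= dim_ctgt; lia.
rewrite table_tgt_cons => -[lt_au lt_av tu sv] /IH.
by case: ifP => [_ _|]; rewrite /= ?dim_ctgt; lia.
Qed.

Lemma linked_src m U : linked U.1 U.2 -> linked (table_src m U).1 (table_src m U).2.
Proof.
case: U => u us; rewrite table_srcE /=; elim: us u => [|[a v] us IH] u //=.
move=> [lt_au lt_av tu sv] /[dup] lv /IH.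
case: (ltnP (dim a) m) => [lt_am|le_ma] /=.
  by rewrite !dim_csrc ctgt_csrc // (csrc_csrc _ (ltnW lt_am)); split => //; lia.
set ws := [seq _ | _ <- _].
have: all (fun p => dim p.1 < m) ws by rewrite all_map; apply: filter_all.
case: ws => [|[b w] ws] //= /andP[lt_bm _]; rewrite !dim_csrc !ctgt_csrc //.
have lt_ba: dim b < dim a by apply: leq_trans le_ma.
move=> [lt_bv lt_bw tv sw lw]; split => //; first by lia.
by rewrite -(ctgt_ctgt u (ltnW lt_ba)) tu -{1}sv ctgt_csrc.
Qed.

Lemma linked_tgt m U : linked U.1 U.2 -> linked (table_tgt m U).1 (table_tgt m U).2.
Proof.
case: U => u us; elim: us u => [|[a v] us IH] u; first by [].
rewrite table_tgt_cons => -[lt_au lt_av tu sv] lv; rewrite /= in lt_au tu.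
case: (ltnP (dim a) m) => [lt_am|le_ma]; last exact: IH.
have := head_tgt m lv; have := table_src_tgt (U := (v, us)) lt_am lv.
case: (table_tgt m (v, us)) (IH v lv) => w ws lw; rewrite !table_srcE => -[e _].
by rewrite /= dim_ctgt (ctgt_ctgt _ (ltnW lt_am)) e => hw; split=> //; lia.
Qed.

Lemma dim_table_src n m U : dim_le n U -> dim_le n (table_src m U).
Proof.
case: U => u us; rewrite table_srcE /dim_le /= dim_csrc => /andP[le_un le_usn].
apply/andP; split; first by lia.
elim: us le_usn => [|[a v] us IH] //= /andP[le_vn /IH].
by case: ifP => //= _ ->; rewrite dim_csrc; lia.
Qed.

Lemma dim_table_tgt n m U : dim_le n U -> dim_le n (table_tgt m U).
Proof.
case: U => u us; elim: us u => [|[a v] us IH] u.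
  by rewrite /dim_le /table_tgt /= /last_entry /= dim_ctgt !andbT; lia.
rewrite table_tgt_cons => /and3P[le_u le_v le_us].
have := IH v (introT andP (conj le_v le_us)).
case: ifP => _ //; case: (table_tgt m (v, us)) => w ws.
by rewrite /dim_le /= dim_ctgt => /andP[-> ->]; rewrite geq_min le_u orbT.
Qed.

Lemma dim_table_src_le m U : dim_le m (table_src m U).
Proof.
case: U => u us; rewrite table_srcE /dim_le /= dim_csrc geq_minl /=.
by elim: us => [|[a v] us IH] //=; case: ifP => //= _; rewrite dim_csrc geq_minl.
Qed.

Lemma dim_table_tgt_le m U : dim_le m (table_tgt m U).
Proof.
case: U => u us; elim: us u => [|[a v] us IH] u.
  by rewrite /dim_le /table_tgt /= /last_entry /= dim_ctgt geq_minl.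
rewrite table_tgt_cons; case: ifP => _ //.
case: (table_tgt m (v, us)) (IH v) => w ws.
by rewrite /dim_le /= dim_ctgt geq_minl.
Qed.

Lemma table_src_id m U : linked U.1 U.2 -> dim_le m U -> table_src m U = U.
Proof.
case: U => u us; rewrite table_srcE /dim_le /= => lu /andP[le_um le_us].
rewrite csrc_id //; congr pair.
elim: us u le_um le_us lu => [|[a v] us IH] u //= le_um /andP[le_vm le_us].
by move=> [lt_au _ _ _ lv]; rewrite (leq_trans lt_au) //= csrc_id // (IH v).
Qed.

Lemma table_tgt_id m U : linked U.1 U.2 -> dim_le m U -> table_tgt m U = U.
Proof.
case: U => u us; rewrite /dim_le /= => lu /andP[].
elim: us u lu => [|[a v] us IH] u /=.
  by rewrite /table_tgt /= /last_entry /= => _ le_um _; rewrite ctgt_id.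
move=> [lt_au _ _ _ lv] le_um /andP[le_vm le_us].
by rewrite table_tgt_cons (leq_trans lt_au) // IH //= ctgt_id.
Qed.

Lemma dim_le_trans m n U : m <= n -> dim_le m U -> dim_le n U.
Proof.
move=> le_mn /andP[le_um le_us]; apply/andP; split; first exact: leq_trans le_mn.
by apply: sub_all le_us => p /leq_trans; apply.
Qed.

End TableLemmas.

Definition pasting_src X n (U : pasting X n.+1) : pasting X n :=
  Pasting (linked_src n (tab_linked U)) (dim_table_src_le n (tab U)).

Definition pasting_tgt X n (U : pasting X n.+1) : pasting X n :=
  Pasting (linked_tgt n (tab_linked U)) (dim_table_tgt_le n (tab U)).

Lemma pasting_src_tgt X n (U : pasting X n.+2) :
  pasting_src (pasting_src U) = pasting_src (pasting_tgt U).
Proof.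
by apply: pasting_inj; rewrite /= table_src_src // table_src_tgt //; apply: tab_linked.
Qed.

Lemma pasting_tgt_src X n (U : pasting X n.+2) :
  pasting_tgt (pasting_src U) = pasting_tgt (pasting_tgt U).
Proof.
by apply: pasting_inj; rewrite /= table_tgt_tgt // table_tgt_src //; apply: tab_linked.
Qed.

Definition T_ob (X : globular_set) : globular_set :=
  GlobularSet (@pasting_src_tgt X) (@pasting_tgt_src X).

Definition cell_map X Y (f : gmap X Y) (c : cell X) : cell Y :=
  Cell (f (projT1 c) (projT2 c)).

Definition table_map X Y (f : gmap X Y) (U : table X) : table Y :=
  (cell_map f U.1, [seq (cell_map f p.1, cell_map f p.2) | p <- U.2]).

Section TableMap.
Variables (X Y : globular_set) (f : gmap X Y).

Lemma csrc_map m c : csrc m (cell_map f c) = cell_map f (csrc m c).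
Proof.
rewrite /csrc /dim /=; elim: (_ - m) => //= k ->.
by case: (iter k _ c) => [[|n] x] //=; rewrite /cell_map /= gmap_src.
Qed.

Lemma ctgt_map m c : ctgt m (cell_map f c) = cell_map f (ctgt m c).
Proof.
rewrite /ctgt /dim /=; elim: (_ - m) => //= k ->.
by case: (iter k _ c) => [[|n] x] //=; rewrite /cell_map /= gmap_tgt.
Qed.

Lemma table_src_map m U : table_src m (table_map f U) = table_map f (table_src m U).
Proof.
case: U => u us; rewrite !table_srcE /table_map /= csrc_map; congr pair.
by elim: us => [|[a v] us IH] //=; case: ifP => //= _; rewrite IH csrc_map.
Qed.

Lemma table_tgt_map m U : table_tgt m (table_map f U) = table_map f (table_tgt m U).
Proof.
case: U => u us; elim: us u => [|[a v] us IH] u.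
  by rewrite /table_map /table_tgt /= /last_entry /= ctgt_map.
rewrite table_tgt_cons [table_map f (u, _)]/= table_tgt_cons -/(table_map f (v, us)).
rewrite IH /=; case: ifP => // _.
by rewrite /table_map /= ctgt_map.
Qed.

Lemma linked_map U : linked U.1 U.2 ->
  linked (table_map f U).1 (table_map f U).2.
Proof.
case: U => u us /=; elim: us u => [|[a v] us IH] u //= [lt_au lt_av tu sv /IH lv].
by split; rewrite // ?ctgt_map ?csrc_map -?[dim (cell_map f a)]/(dim a) ?tu ?sv.
Qed.

Lemma dim_le_map n U : dim_le n U -> dim_le n (table_map f U).
Proof. by rewrite /dim_le /= all_map. Qed.

Definition pasting_map n (U : pasting X n) : pasting Y n :=
  Pasting (linked_map (tab_linked U)) (dim_le_map (tab_dim U)).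

Lemma pasting_map_src n (U : T_ob X n.+1) : pasting_map (src U) = src (pasting_map U : T_ob Y n.+1).
Proof. by apply: pasting_inj; rewrite /= table_src_map. Qed.

Lemma pasting_map_tgt n (U : T_ob X n.+1) : pasting_map (tgt U) = tgt (pasting_map U : T_ob Y n.+1).
Proof. by apply: pasting_inj; rewrite /= table_tgt_map. Qed.

Definition T_map : gmap (T_ob X) (T_ob Y) :=
  @Gmap (T_ob X) (T_ob Y) pasting_map pasting_map_src pasting_map_tgt.

End TableMap.

Section Unit.
Variable X : globular_set.

(* The one-entry diagram [x], regarded as a cell of any dimension n >= m. *)
Definition single m (x : X m) n (le_mn : m <= n) : T_ob X n :=
  @Pasting X n (Cell x, [::]) I (introT andP (conj le_mn isT)).

Definition T_unit_fun n (x : X n) : T_ob X n := single x (leqnn n).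

Lemma T_unit_src n (x : X n.+1) : T_unit_fun (src x) = src (T_unit_fun x).
Proof. by apply: pasting_inj; rewrite /= /table_src /= csrc_Cell. Qed.

Lemma T_unit_tgt n (x : X n.+1) : T_unit_fun (tgt x) = tgt (T_unit_fun x).
Proof. by apply: pasting_inj; rewrite /= /table_tgt /last_entry /= ctgt_Cell. Qed.

Definition T_unit : gmap X (T_ob X) :=
  @Gmap X (T_ob X) T_unit_fun T_unit_src T_unit_tgt.

End Unit.

(* Composite along dimension m of blocks B, C with t_m B = s_m C; a block whose
   first entry has dimension <= m is a one-entry identity. *)
Definition block_comp X m (B C : table X) : table X :=
  if dim B.1 <= m then C
  else if dim C.1 <= m then B
  else (B.1, B.2 ++ (csrc m C.1, C.1) :: C.2).

(* Composite U *_m V of tables with t_m U = s_m V, which have the same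
   bottom entries of dimension < m. *)
Definition table_comp X m (U V : table X) : table X :=
  let BB := blocks m U.1 U.2 in
  let CC := blocks m V.1 V.2 in
  join (block_comp m BB.1 CC.1,
        [seq (p.1.1, block_comp m p.1.2 p.2.2) | p <- zip BB.2 CC.2]).

(* In the next two definitions a pasting diagram of pasting diagrams is given by
   U_0 and the list of the pairs (k_i, U_i), k_i being the dimension of the
   i-th bottom entry. [glue] composes along the bottom entries of dimension
   d - 1, ..., 0 successively. *)
Fixpoint merge X d (U : table X) (Us : seq (nat * table X)) :
    table X * seq (nat * table X) :=
  match Us with
  | [::] => (U, [::])
  | (k, V) :: Us' =>
      let WW := merge d V Us' in
      if k == d then (table_comp d U WW.1, WW.2) else (U, (k, WW.1) :: WW.2)
  end.

Fixpoint glue X d (U : table X) (Us : seq (nat * table X)) : table X :=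
  match d with
  | 0 => U
  | e.+1 => let VV := merge e U Us in glue e VV.1 VV.2
  end.

Section Glue.
Variable X : globular_set.
Implicit Types (u v a : cell X) (us vs : seq (cell X * cell X)) (U V B C : table X).
Implicit Types (Bs Cs : seq (cell X * table X)) (Us : seq (nat * table X)).

Definition is_block m B := all (fun p : cell X * cell X => m <= dim p.1) B.2.

Definition is_blocks m B Bs :=
  is_block m B && all (fun p : cell X * table X => (dim p.1 < m) && is_block m p.2) Bs.

Lemma join_nil B : join (B, [::]) = B.
Proof. by case: B => u us; rewrite /join /= cats0. Qed.

Lemma join_cons u us a C Bs :
  join ((u, us), (a, C) :: Bs) = (u, us ++ (a, (join (C, Bs)).1) :: (join (C, Bs)).2).
Proof. by rewrite /join /=. Qed.

Lemma join_blocks m u us : join (blocks m u us) = (u, us).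
Proof.
elim: us u => [|[a v] us IH] u //=.
have := IH v; case: (blocks m v us) => [[w ws] Bs] e.
by case: ifP => _; [rewrite join_cons e | case: e => <- <-].
Qed.

Lemma blocks_is_blocks m u us : is_blocks m (blocks m u us).1 (blocks m u us).2.
Proof.
elim: us u => [|[a v] us IH] u //=; have := IH v.
case: (blocks m v us) => [[w ws] Bs]; rewrite /is_blocks /is_block /=.
by case: ltnP => h /=; rewrite ?h.
Qed.

Lemma blocks_join m B Bs : is_blocks m B Bs ->
  blocks m (join (B, Bs)).1 (join (B, Bs)).2 = (B, Bs).
Proof.
elim: Bs B => [|[a C] Bs IH] [u us].
  rewrite /is_blocks andbT join_nil /is_block /=.
  by elim: us u => [|[b v] us IHu] u //= /andP[le_mb /IHu ->]; rewrite ltnNge le_mb.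
case/and3P=> bB /andP[lt_am bC] bBs; rewrite join_cons.
have := IH C (introT andP (conj bC bBs)); case: (join (C, Bs)) => w ws /= {}IH.
move: bB; rewrite /is_block /=; elim: us u => [|[b v] us IHu] u /=.
  by rewrite lt_am IH.
by case/andP=> le_mb /IHu ->; rewrite ltnNge le_mb.
Qed.

Fixpoint linked_blocks B Bs : Prop :=
  match Bs with
  | [::] => linked B.1 B.2
  | (a, C) :: Bs' =>
      linked B.1 B.2 /\
      [/\ dim a < dim (last_entry B), dim a < dim C.1, ctgt (dim a) (last_entry B) = a,
          csrc (dim a) C.1 = a & linked_blocks C Bs']
  end.

Lemma linked_cat u us a v vs : linked u (us ++ (a, v) :: vs) <->
  linked u us /\ [/\ dim a < dim (last_entry (u, us)), dim a < dim v,
   ctgt (dim a) (last_entry (u, us)) = a, csrc (dim a) v = a & linked v vs].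
Proof.
elim: us u => [|[b w] us IH] u /=; first by split=> [//|[]].
have -> : last_entry (u, (b, w) :: us) = last_entry (w, us) by [].
split; first by case=> ? ? ? ? /IH[].
by move=> [[? ? ? ? l] [? ? ? ? ?]]; split => //; apply/IH.
Qed.

Lemma linked_join B Bs : linked (join (B, Bs)).1 (join (B, Bs)).2 <-> linked_blocks B Bs.
Proof.
elim: Bs B => [|[a C] Bs IH] [u us]; first by rewrite join_nil.
rewrite join_cons /=; split.
  by case/linked_cat => ? [? ? ? ? /IH].
by move=> [? [? ? ? ? /IH ?]]; apply/linked_cat.
Qed.

Lemma linked_blocksP m U : linked U.1 U.2 ->
  linked_blocks (blocks m U.1 U.2).1 (blocks m U.1 U.2).2.
Proof.
move=> lU; apply/linked_join.
by rewrite -surjective_pairing join_blocks.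
Qed.

Lemma block_single m C : dim C.1 <= m -> linked C.1 C.2 -> is_block m C -> C.2 = [::].
Proof.
case: C => v [|[a w] vs] //= le_vm [lt_av _ _ _ _] /andP[/=]; lia.
Qed.

Lemma dim_last_entry m B : linked B.1 B.2 -> is_block m B -> m < dim B.1 ->
  m < dim (last_entry B).
Proof.
case: B => u us /=; elim: us u => [|[a v] us IH] u //= [_ lt_av _ _ lv].
by case/andP=> /= le_ma bus _; apply: (IH v lv bus); lia.
Qed.

Lemma block_compP m B C : linked B.1 B.2 -> linked C.1 C.2 ->
    is_block m B -> is_block m C -> ctgt m (last_entry B) = csrc m C.1 ->
  let D := block_comp m B C in
  [/\ linked D.1 D.2, is_block m D, csrc m D.1 = csrc m B.1 &
      ctgt m (last_entry D) = ctgt m (last_entry C)].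
Proof.
move=> lB lC bB bC e /=; rewrite /block_comp.
have [le_Bm|lt_mB] := leqP (dim B.1) m.
  have B2 := block_single le_Bm lB bB; split=> //.
  by rewrite -e /last_entry B2 /= ctgt_id // csrc_id.
have [le_Cm|lt_mC] := leqP (dim C.1) m.
  have C2 := block_single le_Cm lC bC; split=> //.
  by rewrite e /last_entry C2 /= csrc_id // ctgt_id.
have lt_m := dim_last_entry lB bB lt_mB.
have dm : dim (csrc m C.1) = m by rewrite dim_csrc; lia.
split => //.
- apply/linked_cat; split=> //; rewrite dm; split=> //.
- by rewrite /is_block all_cat /= dm leqnn andTb; apply/andP.
- by rewrite /last_entry /= /unzip2 map_cat /= last_cat.
Qed.

Definition blocks_comp m Bs Cs : seq (cell X * table X) :=
  [seq (p.1.1, block_comp m p.1.2 p.2.2) | p <- zip Bs Cs].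

Lemma blocks_compP m B C Bs Cs : linked_blocks B Bs -> linked_blocks C Cs ->
    is_blocks m B Bs -> is_blocks m C Cs -> ctgt m (last_entry B) = csrc m C.1 ->
    [seq (p.1, ctgt m (last_entry p.2)) | p <- Bs] =
    [seq (p.1, csrc m p.2.1) | p <- Cs] ->
  let D := block_comp m B C in let Ds := blocks_comp m Bs Cs in
  [/\ linked_blocks D Ds, is_blocks m D Ds,
      [seq (p.1, csrc m p.2.1) | p <- Ds] = [seq (p.1, csrc m p.2.1) | p <- Bs] &
      [seq (p.1, ctgt m (last_entry p.2)) | p <- Ds] =
      [seq (p.1, ctgt m (last_entry p.2)) | p <- Cs]].
Proof.
elim: Bs Cs B C => [|[a B'] Bs IH] [|[b C'] Cs] B C //=.
  move=> lB lC /andP[bB _] /andP[bC _] e _.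
  have [lD bD _ _] := block_compP lB lC bB bC e.
  by split=> //; rewrite /is_blocks bD.
move=> [lB [d1 d2 t1 s1 lBs]] [lC [d3 d4 t2 s2 lCs]].
case/and3P=> bB /andP[/= lt_am bB'] bBs /and3P[bC /andP[/= lt_bm bC'] bCs] e.
case=> eab e' es; subst b.
have [lD bD sD tD] := block_compP lB lC bB bC e.
have bBBs : is_blocks m B' Bs by apply/andP.
have bCCs : is_blocks m C' Cs by apply/andP.
have lB' : linked B'.1 B'.2 by case: (Bs) lBs => [|[? ?] ?] //= [].
have lC' : linked C'.1 C'.2 by case: (Cs) lCs => [|[? ?] ?] //= [].
have [lD' bD' sD' tD'] := block_compP lB' lC' bB' bC' e'.
have [lDs bDs -> ->] := IH _ _ _ lBs lCs bBBs bCCs e' es.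
rewrite /= sD' tD'; split => //; last by rewrite /is_blocks /= bD lt_am.
split=> //; split => //.
- have := congr1 (@dim X) tD; rewrite !dim_ctgt; lia.
- have := congr1 (@dim X) sD'; rewrite !dim_csrc; lia.
- by rewrite -(ctgt_ctgt _ (ltnW lt_am)) tD ctgt_ctgt // ltnW.
- by rewrite -(csrc_csrc _ (ltnW lt_am)) sD' csrc_csrc // ltnW.
Qed.

Lemma table_compP m U V : linked U.1 U.2 -> linked V.1 V.2 ->
    table_tgt m U = table_src m V ->
  let W := table_comp m U V in
  [/\ linked W.1 W.2, table_src m W = table_src m U & table_tgt m W = table_tgt m V].
Proof.
move=> lU lV [e es].
have lB := linked_blocksP m lU; have lC := linked_blocksP m lV.
have bB := blocks_is_blocks m U.1 U.2; have bC := blocks_is_blocks m V.1 V.2.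
have [lD bD sD tD] := blocks_compP lB lC bB bC e es.
have lB' : linked (blocks m U.1 U.2).1.1 (blocks m U.1 U.2).1.2.
  by case: (blocks m U.1 U.2).2 lB => [|[? ?] ?] //= [].
have lC' : linked (blocks m V.1 V.2).1.1 (blocks m V.1 V.2).1.2.
  by case: (blocks m V.1 V.2).2 lC => [|[? ?] ?] //= [].
case/andP: (bB) => bB' _; case/andP: (bC) => bC' _.
have [_ _ s0 t0] := block_compP lB' lC' bB' bC' e.
rewrite /table_comp -/(blocks_comp _ _ _) /=; split; first exact/linked_join.
  by rewrite /table_src blocks_join //= s0 sD.
by rewrite /table_tgt blocks_join //= t0 tD.
Qed.

Lemma table_comp_src p m U V : linked U.1 U.2 -> linked V.1 V.2 -> p <= m ->
  table_tgt m U = table_src m V -> table_src p (table_comp m U V) = table_src p U.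
Proof.
move=> lU lV le_pm /(table_compP lU lV)[_ e _].
by rewrite -(table_src_src _ le_pm) e table_src_src.
Qed.

Lemma table_comp_tgt p m U V : linked U.1 U.2 -> linked V.1 V.2 -> p <= m ->
  table_tgt m U = table_src m V -> table_tgt p (table_comp m U V) = table_tgt p V.
Proof.
move=> lU lV le_pm /(table_compP lU lV)[_ _ e].
by rewrite -(table_tgt_tgt _ le_pm) e table_tgt_tgt.
Qed.

Lemma dim_le_join n B Bs :
  dim_le n (join (B, Bs)) = dim_le n B && all (fun p => dim_le n p.2) Bs.
Proof.
elim: Bs B => [|[a C] Bs IH] [u us]; first by rewrite join_nil andbT.
rewrite /= -IH join_cons; case: (join (C, Bs)) => w ws.
by rewrite /dim_le /= all_cat /= !andbA.
Qed.

Lemma dim_le_blocks n m U : dim_le n U ->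
  dim_le n (blocks m U.1 U.2).1 && all (fun p => dim_le n p.2) (blocks m U.1 U.2).2.
Proof.
by rewrite -dim_le_join -surjective_pairing join_blocks -surjective_pairing.
Qed.

Lemma dim_le_block_comp n m B C : dim_le n B -> dim_le n C -> dim_le n (block_comp m B C).
Proof.
rewrite /block_comp; case: ifP => // _; case: ifP => // _.
case/andP=> B1 B2 /andP[C1 C2].
by rewrite /dim_le /= B1 all_cat B2 /= C1.
Qed.

Lemma dim_le_comp n m U V : dim_le n U -> dim_le n V -> dim_le n (table_comp m U V).
Proof.
move=> /(dim_le_blocks m)/andP[B Bs] /(dim_le_blocks m)/andP[C Cs].
rewrite /table_comp dim_le_join dim_le_block_comp //=.
elim: (blocks m U.1 U.2).2 (blocks m V.1 V.2).2 Bs Cs => [|[a B'] Bs IH] [|[b C'] Cs] //=.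
by case/andP=> ? ? /andP[? ?]; rewrite dim_le_block_comp // IH.
Qed.

Lemma table_src_cat p u us a v vs : dim a < p ->
  table_src p (u, us ++ (a, v) :: vs) =
  ((table_src p (u, us)).1,
   (table_src p (u, us)).2 ++ (a, (table_src p (v, vs)).1) :: (table_src p (v, vs)).2).
Proof. by move=> lt_ap; rewrite !table_srcE filter_cat map_cat /= lt_ap. Qed.

Lemma table_tgt_cat p u us a v vs : dim a < p ->
  table_tgt p (u, us ++ (a, v) :: vs) =
  ((table_tgt p (u, us)).1,
   (table_tgt p (u, us)).2 ++ (a, (table_tgt p (v, vs)).1) :: (table_tgt p (v, vs)).2).
Proof.
move=> lt_ap; elim: us u => [|[b w] us IH] u; first by rewrite table_tgt_cons lt_ap.
by rewrite cat_cons !table_tgt_cons IH; case: ifP.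
Qed.

Lemma table_src_join p B Bs : all (fun q => dim q.1 < p) Bs ->
  table_src p (join (B, Bs)) =
  join (table_src p B, [seq (q.1, table_src p q.2) | q <- Bs]).
Proof.
elim: Bs B => [|[a C] Bs IH] [u us]; first by rewrite !join_nil.
case/andP=> lt_ap /IH {IH}/(_ C); rewrite join_cons map_cons.
case: (join (C, Bs)) => w ws IH; rewrite table_src_cat // IH.
by case: (table_src p (u, us)) => x xs; rewrite join_cons.
Qed.

Lemma table_tgt_join p B Bs : all (fun q => dim q.1 < p) Bs ->
  table_tgt p (join (B, Bs)) =
  join (table_tgt p B, [seq (q.1, table_tgt p q.2) | q <- Bs]).
Proof.
elim: Bs B => [|[a C] Bs IH] [u us]; first by rewrite !join_nil.
case/andP=> lt_ap /IH {IH}/(_ C); rewrite join_cons map_cons.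
case: (join (C, Bs)) => w ws IH; rewrite table_tgt_cat // IH.
by case: (table_tgt p (u, us)) => x xs; rewrite join_cons.
Qed.

Lemma is_block_src m p B : is_block m B -> is_block m (table_src p B).
Proof.
case: B => u us; rewrite table_srcE /is_block /= all_map.
by elim: us => [|[a v] us IH] //= /andP[le_ma /IH]; case: ifP => //= _ ->; rewrite le_ma.
Qed.

Lemma is_block_tgt m p B : is_block m B -> is_block m (table_tgt p B).
Proof.
case: B => u us; elim: us u => [|[a v] us IH] u // /andP[le_ma /(IH v)].
rewrite table_tgt_cons; case: ifP => // _; case: (table_tgt p (v, us)) => w ws.
by rewrite /is_block /= => ->; rewrite andbT.
Qed.

Lemma blocks_seps m u us : all (fun q => dim q.1 < m) (blocks m u us).2.
Proof.
by case/andP: (blocks_is_blocks m u us) => _; apply: sub_all => q /andP[].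
Qed.

Lemma sub_seps m p Bs : m <= p -> all (fun q => dim q.1 < m) Bs ->
  all (fun q => dim q.1 < p) Bs.
Proof. by move=> le_mp; apply: sub_all => q /leq_trans; apply. Qed.

Lemma blocks_table_src m p U : m <= p ->
  blocks m (table_src p U).1 (table_src p U).2 =
  (table_src p (blocks m U.1 U.2).1,
   [seq (q.1, table_src p q.2) | q <- (blocks m U.1 U.2).2]).
Proof.
case: U => u us le_mp; rewrite -{1 2}(join_blocks m u us).
rewrite [X in join X]surjective_pairing table_src_join; last first.
  exact: sub_seps (blocks_seps _ _ _).
apply: blocks_join; case/andP: (blocks_is_blocks m u us) => b1 b2.
rewrite /is_blocks is_block_src //= all_map; apply: sub_all b2 => q /andP[/= -> /=].
exact: is_block_src.
Qed.

Lemma blocks_table_tgt m p U : m <= p ->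
  blocks m (table_tgt p U).1 (table_tgt p U).2 =
  (table_tgt p (blocks m U.1 U.2).1,
   [seq (q.1, table_tgt p q.2) | q <- (blocks m U.1 U.2).2]).
Proof.
case: U => u us le_mp; rewrite -{1 2}(join_blocks m u us).
rewrite [X in join X]surjective_pairing table_tgt_join; last first.
  exact: sub_seps (blocks_seps _ _ _).
apply: blocks_join; case/andP: (blocks_is_blocks m u us) => b1 b2.
rewrite /is_blocks is_block_tgt //= all_map; apply: sub_all b2 => q /andP[/= -> /=].
exact: is_block_tgt.
Qed.

Lemma block_comp_src m p B C : m < p ->
  table_src p (block_comp m B C) = block_comp m (table_src p B) (table_src p C).
Proof.
case: B C => u us [v vs] lt_mp; rewrite /block_comp !table_srcE /= !dim_csrc.
have -> : (minn p (dim u) <= m) = (dim u <= m) by lia.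
have -> : (minn p (dim v) <= m) = (dim v <= m) by lia.
case: ifP => _; first by rewrite table_srcE.
case: ifP => _; first by rewrite table_srcE.
rewrite table_srcE filter_cat map_cat /= dim_csrc.
have -> : minn m (dim v) < p by lia.
by rewrite /= csrc_csrc // ltnW.
Qed.

Lemma block_comp_tgt m p B C : m < p -> linked B.1 B.2 -> linked C.1 C.2 ->
  table_tgt p (block_comp m B C) = block_comp m (table_tgt p B) (table_tgt p C).
Proof.
case: B C => u us [v vs] lt_mp lB lC; rewrite /block_comp.
have dB : (dim (table_tgt p (u, us)).1 <= m) = (dim u <= m).
  by have := head_tgt p lB; rewrite /=; lia.
have dC : (dim (table_tgt p (v, vs)).1 <= m) = (dim v <= m).
  by have := head_tgt p lC; rewrite /=; lia.
rewrite dB dC [(u, us).1]/= [(v, vs).1]/=.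
case: ifP => // _; case: ifP => // le_vm.
rewrite table_tgt_cat ?dim_csrc; last by lia.
have := table_src_tgt (U := (v, vs)) lt_mp lC.
by case: (table_tgt p (v, vs)) => w ws; rewrite !table_srcE => -[-> _].
Qed.

Lemma table_src_comp m p U V : m < p ->
  table_src p (table_comp m U V) = table_comp m (table_src p U) (table_src p V).
Proof.
move=> lt_mp; have le_mp := ltnW lt_mp.
rewrite {2}/table_comp !blocks_table_src // /table_comp table_src_join.
  rewrite block_comp_src //; congr (join (_, _)) => /=.
  elim: (blocks m U.1 U.2).2 (blocks m V.1 V.2).2 => [|[a B] Bs IH] [|[b C] Cs] //=.
  by rewrite IH block_comp_src.
have := sub_seps le_mp (blocks_seps m U.1 U.2).
elim: (blocks m U.1 U.2).2 (blocks m V.1 V.2).2 => [|[a B] Bs IH] [|[b C] Cs] //=.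
by case/andP=> -> /IH ->.
Qed.

Lemma linked_block B Bs : linked_blocks B Bs -> linked B.1 B.2.
Proof. by case: Bs => [|[? ?] ?] //= []. Qed.

Lemma table_tgt_comp m p U V : m < p -> linked U.1 U.2 -> linked V.1 V.2 ->
  table_tgt p (table_comp m U V) = table_comp m (table_tgt p U) (table_tgt p V).
Proof.
move=> lt_mp /(linked_blocksP m) lU /(linked_blocksP m) lV; have le_mp := ltnW lt_mp.
rewrite {2}/table_comp !blocks_table_tgt // /table_comp table_tgt_join.
  rewrite block_comp_tgt //; [|exact: linked_block lU|exact: linked_block lV].
  congr (join (_, _)) => /=.
  elim: (blocks m U.1 U.2).2 (blocks m V.1 V.2).2 (blocks m U.1 U.2).1
    (blocks m V.1 V.2).1 lU lV => [|[a B] Bs IH] [|[b C] Cs] B0 C0 //=.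
  move=> [_ [_ _ _ _ lB]] [_ [_ _ _ _ lC]].
  rewrite (IH _ _ _ lB lC) block_comp_tgt //; [exact: linked_block lB|exact: linked_block lC].
have := sub_seps le_mp (blocks_seps m U.1 U.2).
elim: (blocks m U.1 U.2).2 (blocks m V.1 V.2).2 => [|[a B] Bs IH] [|[b C] Cs] //=.
by case/andP=> -> /IH ->.
Qed.

(* Consecutive composability of the (U_i, k_i), with every k_i < d. *)
Fixpoint glueable d U Us : Prop :=
  match Us with
  | [::] => linked U.1 U.2
  | (k, V) :: Us' =>
      [/\ linked U.1 U.2, k < d, table_tgt k U = table_src k V & glueable d V Us']
  end.

Lemma glueable_head d U Us : glueable d U Us -> linked U.1 U.2.
Proof. by case: Us => [|[k V] Us] //= []. Qed.

Lemma merge_src d U Us p : glueable d.+1 U Us -> p <= d ->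
  table_src p (merge d U Us).1 = table_src p U /\ glueable d (merge d U Us).1 (merge d U Us).2.
Proof.
move=> g; elim: Us U p g => [|[k V] Us IH] U p //= [lU lt_kd e /IH {}IH] le_pd.
have [eV gV] := IH k lt_kd; have lV := glueable_head gV.
case: eqP => [ekd|nekd] /=; last by split=> //; split=> //; [lia|rewrite eV].
subst k; have e' : table_tgt d U = table_src d (merge d V Us).1 by rewrite eV.
split; first by rewrite table_comp_src.
have [lW _ tW] := table_compP lU lV e'.
case: (merge d V Us).2 gV => [|[k W] Ws] //= [_ lt_k e2 g].
by split=> //; rewrite table_comp_tgt // ltnW.
Qed.

Lemma glueP d U Us : glueable d U Us -> linked (glue d U Us).1 (glue d U Us).2.
Proof.
elim: d U Us => [|d IH] U Us /=; first exact: glueable_head.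
by case/(merge_src (p := 0)) => // _ /IH.
Qed.

Lemma dim_le_merge n d U Us : dim_le n U -> all (fun p => dim_le n p.2) Us ->
  dim_le n (merge d U Us).1 && all (fun p => dim_le n p.2) (merge d U Us).2.
Proof.
elim: Us U => [|[k V] Us IH] U /=; first by move=> ->.
move=> dU /andP[/IH dV /dV /andP[d1 d2]].
by case: ifP => _ /=; rewrite ?dim_le_comp // dU d1 d2.
Qed.

Lemma dim_le_glue n d U Us : dim_le n U -> all (fun p => dim_le n p.2) Us ->
  dim_le n (glue d U Us).
Proof.
elim: d U Us => [|d IH] U Us //= dU /(dim_le_merge d dU)/andP[]; exact: IH.
Qed.

Lemma merge_table_src p d U Us : d < p ->
  merge d (table_src p U) [seq (q.1, table_src p q.2) | q <- Us] =
  (table_src p (merge d U Us).1, [seq (q.1, table_src p q.2) | q <- (merge d U Us).2]).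
Proof.
move=> lt_dp; elim: Us U => [|[k V] Us IH] U //=; rewrite IH.
by case: ifP => _ //=; rewrite table_src_comp.
Qed.

Lemma glue_table_src p d U Us : d <= p ->
  glue d (table_src p U) [seq (q.1, table_src p q.2) | q <- Us] = table_src p (glue d U Us).
Proof. by elim: d U Us => [|d IH] U Us lt_dp //=; rewrite merge_table_src // IH // ltnW. Qed.

Lemma merge_table_tgt p d U Us : d < p -> glueable d.+1 U Us ->
  merge d (table_tgt p U) [seq (q.1, table_tgt p q.2) | q <- Us] =
  (table_tgt p (merge d U Us).1, [seq (q.1, table_tgt p q.2) | q <- (merge d U Us).2]).
Proof.
move=> lt_dp; elim: Us U => [|[k V] Us IH] U //= [lU lt_kd e g]; rewrite IH //.
case: ifP => _ //=; rewrite table_tgt_comp //.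
by have [_ /glueable_head] := merge_src g (leq0n _).
Qed.

Lemma glue_table_tgt p d U Us : d <= p -> glueable d U Us ->
  glue d (table_tgt p U) [seq (q.1, table_tgt p q.2) | q <- Us] = table_tgt p (glue d U Us).
Proof.
elim: d U Us => [|d IH] U Us lt_dp g //=; rewrite merge_table_tgt // IH // 1?ltnW //.
by have [] := merge_src g (leq0n _).
Qed.

Lemma table_src_merge d U Us : glueable d.+1 U Us ->
  [seq (q.1, table_src d q.2) | q <- (merge d U Us).2] =
  [seq (q.1, table_src d q.2) | q <- Us & q.1 < d].
Proof.
elim: Us U => [|[k V] Us IH] U //= [lU lt_kd _ g].
have [e _] := merge_src g (leqnn d).
case: eqP => [->|nekd] /=; first by rewrite ltnn IH.
have -> : k < d by lia.
by rewrite /= e IH.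
Qed.

Lemma table_tgt_merge d U Us : glueable d.+1 U Us ->
  (table_tgt d (merge d U Us).1, [seq (q.1, table_tgt d q.2) | q <- (merge d U Us).2]) =
  match Us with
  | [::] => (table_tgt d U, [::])
  | (k, V) :: Us' =>
      let W := (table_tgt d (merge d V Us').1,
                [seq (q.1, table_tgt d q.2) | q <- (merge d V Us').2]) in
      if k == d then W else (table_tgt d U, (k, W.1) :: W.2)
  end.
Proof.
case: Us => [|[k V] Us] //= [lU lt_kd e g].
have [eV /glueable_head lV] := merge_src g lt_kd.
case: eqP => [ekd|//]; subst k; rewrite table_comp_tgt //.
by rewrite eV.
Qed.

End Glue.

Section Mult.
Variable X : globular_set.
Implicit Types (c : cell (T_ob X)) (U : table (T_ob X)).

Definition inner c : table X := tab (projT2 c).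

Definition inners U : seq (nat * table X) := [seq (dim p.1, inner p.2) | p <- U.2].

Lemma inner_csrc m c : inner (csrc m c) = table_src m (inner c).
Proof.
have [k] := ubnP (dim c - m); elim: k c => // k IH c.
have [le_cm|lt_mc] := leqP (dim c) m.
  rewrite csrc_id // table_src_id //; first exact: tab_linked.
  exact: dim_le_trans le_cm (tab_dim _).
case: c lt_mc => [[|n] c] //= lt_mc lt_k; have le_mn : m <= n by [].
rewrite -(csrc_csrc (X := T_ob X) _ le_mn) (csrc_Cell c) IH; last by rewrite /=; lia.
by rewrite /inner /= table_src_src.
Qed.

Lemma inner_ctgt m c : inner (ctgt m c) = table_tgt m (inner c).
Proof.
have [k] := ubnP (dim c - m); elim: k c => // k IH c.
have [le_cm|lt_mc] := leqP (dim c) m.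
  rewrite ctgt_id // table_tgt_id //; first exact: tab_linked.
  exact: dim_le_trans le_cm (tab_dim _).
case: c lt_mc => [[|n] c] //= lt_mc lt_k; have le_mn : m <= n by [].
rewrite -(ctgt_ctgt (X := T_ob X) _ le_mn) (ctgt_Cell c) IH; last by rewrite /=; lia.
by rewrite /inner /= table_tgt_tgt.
Qed.

Lemma glueable_inners n U : linked U.1 U.2 -> dim_le n U ->
  glueable n (inner U.1) (inners U).
Proof.
case: U => u us; rewrite /dim_le /inners /= => lu /andP[le_u le_us].
elim: us u lu le_u le_us => [|[a v] us IH] u /=; first by move=> *; apply: tab_linked.
move=> [lt_au lt_av tu sv lv] le_u /andP[le_v le_us]; split.
- exact: tab_linked.
- exact: leq_trans le_u.
- by rewrite -inner_csrc sv -inner_ctgt tu.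
- exact: IH.
Qed.

Lemma dim_le_inners n U : dim_le n U ->
  dim_le n (inner U.1) && all (fun p => dim_le n p.2) (inners U).
Proof.
case/andP=> le1 le2; apply/andP; split; first exact: dim_le_trans le1 (tab_dim _).
by rewrite all_map; apply: sub_all le2 => p /= le_p; apply: dim_le_trans le_p (tab_dim _).
Qed.

Lemma T_mult_linked n (U : T_ob (T_ob X) n) :
  let V := glue n (inner (tab U).1) (inners (tab U)) in linked V.1 V.2.
Proof. by apply: glueP; apply: glueable_inners; [apply: tab_linked|apply: tab_dim]. Qed.

Lemma T_mult_dim n (U : T_ob (T_ob X) n) :
  dim_le n (glue n (inner (tab U).1) (inners (tab U))).
Proof. by case/andP: (dim_le_inners (tab_dim U)) => *; apply: dim_le_glue. Qed.

Definition T_mult_fun n (U : T_ob (T_ob X) n) : T_ob X n :=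
  Pasting (T_mult_linked U) (T_mult_dim U).

Lemma T_mult_src n (U : T_ob (T_ob X) n.+1) : T_mult_fun (src U) = src (T_mult_fun U).
Proof.
have g := glueable_inners (tab_linked U) (tab_dim U).
have [e _] := merge_src g (leqnn n).
apply: pasting_inj; rewrite /= -glue_table_src // e table_src_merge //.
case: (tab U) => u us; rewrite table_srcE /inners /= blocks_head inner_csrc.
congr (glue _ _ _); rewrite {U g e}; elim: us => [|[a v] us IH] //=.
by case: ifP => //= _; rewrite IH inner_csrc.
Qed.

Lemma T_mult_tgt n (U : T_ob (T_ob X) n.+1) : T_mult_fun (tgt U) = tgt (T_mult_fun U).
Proof.
have g := glueable_inners (tab_linked U) (tab_dim U).
have [_ g'] := merge_src g (leq0n _).
apply: pasting_inj; rewrite /= -glue_table_tgt //.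
have e : (inner (table_tgt n (tab U)).1, inners (table_tgt n (tab U))) =
   (table_tgt n (merge n (inner (tab U).1) (inners (tab U))).1,
    [seq (q.1, table_tgt n q.2) | q <- (merge n (inner (tab U).1) (inners (tab U))).2]).
  case: (tab U) g {g'} => u us; elim: us u => [|[a v] us IH] u g.
    by rewrite /inners /= inner_ctgt.
  rewrite table_tgt_merge //; case: g => [_ lt_an _ /IH e].
  rewrite table_tgt_cons; case: ltnP => ha.
    rewrite ifN; last by rewrite neq_ltn ha.
    exact: (congr2 pair (inner_ctgt n u)
      (congr2 cons (congr1 (pair (dim a)) (congr1 fst e)) (congr1 snd e))).
  by rewrite ifT // eqn_leq ha andbT.
exact: (congr2 (glue n) (congr1 fst e) (congr1 snd e)).
Qed.

Definition T_mult : gmap (T_ob (T_ob X)) (T_ob X) :=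
  @Gmap (T_ob (T_ob X)) (T_ob X) T_mult_fun T_mult_src T_mult_tgt.

End Mult.

(* The laws are stated separately, in [is_monad]. *)
Record monad_data := MonadData {
  ob :> globular_set -> globular_set;
  fmap : forall X Y, gmap X Y -> gmap (ob X) (ob Y);
  eta : forall X, gmap X (ob X);
  mu : forall X, gmap (ob (ob X)) (ob X) }.

Arguments fmap M {X Y} f : rename.
Arguments eta M X : rename.
Arguments mu M X : rename.

Record is_monad (P : monad_data) : Prop := IsMonad {
  fmap_id : forall X n (w : P X n), fmap P (gid X) n w = w;
  fmap_comp : forall X Y Z (g : gmap Y Z) (f : gmap X Y) n (w : P X n),
    fmap P (gcomp g f) n w = fmap P g n (fmap P f n w);
  eta_nat : forall (X Y : globular_set) (f : gmap X Y) n (x : X n),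
    fmap P f n (eta P X n x) = eta P Y n (f n x);
  mu_nat : forall X Y (f : gmap X Y) n (w : P (P X) n),
    fmap P f n (mu P X n w) = mu P Y n (fmap P (fmap P f) n w);
  mu_eta : forall X n (w : P X n), mu P X n (eta P (P X) n w) = w;
  mu_fmap_eta : forall X n (w : P X n), mu P X n (fmap P (eta P X) n w) = w;
  mu_mu : forall X n (w : P (P (P X)) n),
    mu P X n (mu P (P X) n w) = mu P X n (fmap P (mu P X) n w) }.

Record is_monad_morphism (P Q : monad_data) (f : forall X, gmap (P X) (Q X)) : Prop :=
  IsMonadMorphism {
    morphism_nat : forall X Y (h : gmap X Y) n (w : P X n),
      f Y n (fmap P h n w) = fmap Q h n (f X n w);
    morphism_eta : forall (X : globular_set) n (x : X n), f X n (eta P X n x) = eta Q X n x;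
    morphism_mu : forall X n (w : P (P X) n),
      f X n (mu P X n w) = mu Q X n (fmap Q (f X) n (f (P X) n w)) }.

Definition T : monad_data := MonadData T_map T_unit T_mult.

(* Cartesian monads over T with contraction. A morphism from the boundary of the
   (n+1)-globe to P 1 is given as a parallel pair (a, b) of n-cells, a morphism
   from the (n+1)-globe to T 1 as an (n+1)-cell k, and the commutation of the
   resulting square as the two equations on ar a and ar b. *)
Record contraction_monad := ContractionMonad {
  cm_monad :> monad_data;
  cm_is_monad : is_monad cm_monad;
  ar : forall X, gmap (cm_monad X) (T X);
  ar_morphism : is_monad_morphism ar;
  ar_cartesian : forall X Y (f : gmap X Y),
    is_pullback (fmap cm_monad f) (ar X) (ar Y) (fmap T f);
  kappa : forall n (a b : cm_monad gone n) (k : T gone n.+1),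
    parallel a b -> ar gone n a = src k -> ar gone n b = tgt k -> cm_monad gone n.+1;
  kappa_src : forall n a b k (hab : parallel a b) (ha : ar gone n a = src k)
    (hb : ar gone n b = tgt k), src (kappa hab ha hb) = a;
  kappa_tgt : forall n a b k (hab : parallel a b) (ha : ar gone n a = src k)
    (hb : ar gone n b = tgt k), tgt (kappa hab ha hb) = b;
  kappa_ar : forall n a b k (hab : parallel a b) (ha : ar gone n a = src k)
    (hb : ar gone n b = tgt k), ar gone n.+1 (kappa hab ha hb) = k }.

Arguments ar c X : rename.

(* In [cm_kappa] the conditions on the images of a and b follow from the
   remaining fields; they are quantified over only so that the right-hand side
   can be written. *)
Record contraction_morphism (P Q : contraction_monad) := ContractionMorphism {
  cm_fun :> forall X, gmap (P X) (Q X);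
  cm_morphism : is_monad_morphism cm_fun;
  cm_ar : forall X n (w : P X n), ar Q X n (cm_fun X n w) = ar P X n w;
  cm_kappa : forall n (a b : P gone n) (k : T gone n.+1)
    (hab : parallel a b) (ha : ar P gone n a = src k) (hb : ar P gone n b = tgt k)
    (hab' : parallel (cm_fun gone n a) (cm_fun gone n b))
    (ha' : ar Q gone n (cm_fun gone n a) = src k)
    (hb' : ar Q gone n (cm_fun gone n b) = tgt k),
    cm_fun gone n.+1 (kappa hab ha hb) = kappa hab' ha' hb' }.

Definition is_initial (L : contraction_monad) : Prop :=
  forall P : contraction_monad,
    exists f : contraction_morphism L P,
      forall (g : contraction_morphism L P) X n (w : L X n), g X n w = f X n w.

Record is_algebra (M : monad_data) (X : globular_set) (xi : gmap (M X) X) : Prop :=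
  IsAlgebra {
    algebra_eta : forall n (x : X n), xi n (eta M X n x) = x;
    algebra_mu : forall n (w : M (M X) n), xi n (mu M X n w) = xi n (fmap M xi n w) }.

(* A weak omega-category is an [algebra] of the initial contraction monad. *)
Record algebra (M : monad_data) := Algebra {
  carrier :> globular_set;
  str : gmap (M carrier) carrier;
  str_is_algebra : is_algebra str }.

Arguments str {M} a.

Record strict_functor (M : monad_data) (A B : algebra M) := StrictFunctor {
  sf_map :> gmap A B;
  sf_str : forall n (w : M A n), sf_map n (str A n w) = str B n (fmap M sf_map n w) }.

Definition is_monic (M : monad_data) (A B : algebra M) (f : strict_functor A B) : Prop :=
  forall (C : algebra M) (g h : strict_functor C A),
    (forall n x, f n (g n x) = f n (h n x)) -> forall n x, g n x = h n x.

Lemma gone_src_tgt m (U : table gone) : linked U.1 U.2 -> table_src m U = table_tgt m U.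
Proof.
have e1 (c : cell gone) : csrc m c = ctgt m c by [].
have e2 : forall c d : cell gone, dim c = dim d -> c = d.
  by move=> [i []] [j []] /= <-.
case: U => u us; elim: us u => [|[a v] us IH] u //= [lt_au lt_av _ _ /IH].
rewrite table_tgt_cons => <-; rewrite !table_srcE /= e1.
case: ltnP => //= le_ma; congr pair; rewrite -e1; apply: e2.
by rewrite !dim_csrc; lia.
Qed.

Lemma T_gone_src_tgt n (k : T gone n.+1) : src k = tgt k.
Proof. by apply: pasting_inj; rewrite /= gone_src_tgt //; apply: tab_linked. Qed.

Section Operations.
Variable L : contraction_monad.

Definition e_tilde n : L gone n := eta L gone n tt.

(* k = [n] *)
Definition is_unit_scheme n (k : T gone n) : bool :=
  nilp (tab k).2 && (dim (tab k).1 == n).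

Lemma ar_e_tilde n (k : T gone n) : is_unit_scheme k -> ar L gone n (e_tilde n) = k.
Proof.
rewrite (morphism_eta (ar_morphism L)) => /andP[/nilP e1 /eqP e2].
apply: pasting_inj; rewrite /= [RHS]surjective_pairing e1; congr pair.
by case: (tab k).1 e2 => i [] /= ->.
Qed.

Lemma ar_e_tilde0 (k : T gone 0) : ar L gone 0 (e_tilde 0) = k.
Proof.
apply: ar_e_tilde; rewrite /is_unit_scheme; have := tab_linked k; have := tab_dim k.
case: (tab k) => u [|[a v] us] /andP[/= d _]; first by rewrite -leqn0.
by case=> lt_au; rewrite leqn0 in d; rewrite (eqP d) in lt_au.
Qed.

Lemma parallel_refl (X : globular_set) n (x : X n) : parallel x x.
Proof. by case: n x => [|n] x. Qed.

(* The standard pasting instruction, together with the fact that its arity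
   is the given scheme, which the recursion needs. *)
Fixpoint sp_sig n : forall k : T gone n, {phi : L gone n | ar L gone n phi = k} :=
  match n with
  | 0 => fun k => exist _ (e_tilde 0) (ar_e_tilde0 k)
  | m.+1 => fun k =>
      match boolP (is_unit_scheme k) with
      | AltTrue h => exist _ (e_tilde m.+1) (ar_e_tilde h)
      | AltFalse _ =>
          let s := sp_sig (src k) in
          exist _ (kappa (parallel_refl (sval s)) (svalP s)
                     (etrans (svalP s) (T_gone_src_tgt k)))
                  (kappa_ar _ _ _)
      end
  end.

Definition sp n (k : T gone n) : L gone n := sval (sp_sig k).

Lemma ar_sp n (k : T gone n) : ar L gone n (sp k) = k.
Proof. exact: (svalP (sp_sig k)). Qed.

End Operations.

Arguments sp L {n} k.

Section ExplicitPullback.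
Variables (B C D : globular_set) (f : gmap B D) (g : gmap C D).

Definition pb_cell n := {p : B n * C n | f n p.1 = g n p.2}.

Lemma pb_src_proof n (p : pb_cell n.+1) : f n (src (sval p).1) = g n (src (sval p).2).
Proof. by rewrite !gmap_src (svalP p). Qed.

Lemma pb_tgt_proof n (p : pb_cell n.+1) : f n (tgt (sval p).1) = g n (tgt (sval p).2).
Proof. by rewrite !gmap_tgt (svalP p). Qed.

Definition pb_src n (p : pb_cell n.+1) : pb_cell n :=
  exist _ (src (sval p).1, src (sval p).2) (pb_src_proof p).
Definition pb_tgt n (p : pb_cell n.+1) : pb_cell n :=
  exist _ (tgt (sval p).1, tgt (sval p).2) (pb_tgt_proof p).

Lemma pb_src_tgt n (p : pb_cell n.+2) : pb_src (pb_src p) = pb_src (pb_tgt p).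
Proof. by apply: eq_exist; rewrite /= !src_tgt. Qed.

Lemma pb_tgt_src n (p : pb_cell n.+2) : pb_tgt (pb_src p) = pb_tgt (pb_tgt p).
Proof. by apply: eq_exist; rewrite /= !tgt_src. Qed.

Definition pb : globular_set := GlobularSet pb_src_tgt pb_tgt_src.

Definition pb_fst : gmap pb B :=
  @Gmap pb B (fun _ p => (sval p).1) (fun _ _ => erefl) (fun _ _ => erefl).
Definition pb_snd : gmap pb C :=
  @Gmap pb C (fun _ p => (sval p).2) (fun _ _ => erefl) (fun _ _ => erefl).

End ExplicitPullback.

Section Pairs.
Variables (L : contraction_monad) (Y : globular_set).

Lemma pair_exists n (phi : L gone n) (u : T Y n) :
  fmap T (gbang Y) n u = ar L gone n phi ->
  exists w : L Y n, fmap L (gbang Y) n w = phi /\ ar L Y n w = u.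
Proof.
move=> e; have [_ pbL] := ar_cartesian L (gbang Y).
have [l [[l1 l2] _]] := pbL _ (pb_fst (ar L gone) (fmap T (gbang Y)))
   (pb_snd (ar L gone) (fmap T (gbang Y))) (fun n z => svalP z).
by exists (l n (exist _ (phi, u) (esym e))); rewrite l1 l2.
Qed.

(* The n-cell (phi, u) of L Y, which is unique by [ar_cartesian]. *)
Definition pair_cell n (phi : L gone n) (u : T Y n)
    (e : fmap T (gbang Y) n u = ar L gone n phi) : L Y n :=
  sval (cid (pair_exists e)).

End Pairs.

Section WeakOmegaCategory.
Variables (L : contraction_monad) (X : algebra L).

Lemma id_shape n (x : X n) :
  fmap T (gbang X) n.+1 (single x (leqnSn n)) =
  ar L gone n.+1 (sp L (single (tt : gone n) (leqnSn n))).
Proof. by rewrite ar_sp; apply: pasting_inj. Qed.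

Definition id_cell n (x : X n) : X n.+1 := str X n.+1 (pair_cell (id_shape x)).

Lemma binary_linked (Y : globular_set) n (u v : Y n.+1) : tgt u = src v ->
  linked (Cell u) [:: (Cell (tgt u), Cell v)].
Proof. by move=> e; split; rewrite //= ?ctgt_Cell ?csrc_Cell ?e. Qed.

Lemma binary_dim (Y : globular_set) n (u v : Y n.+1) :
  dim_le n.+1 (Cell u, [:: (Cell (tgt u), Cell v)]).
Proof. by rewrite /dim_le /= leqnn. Qed.

(* The diagram with top row u, v and bottom row y = t(u) = s(v). *)
Definition binary (Y : globular_set) n (u v : Y n.+1) (e : tgt u = src v) : T Y n.+1 :=
  @Pasting Y n.+1 (Cell u, [:: (Cell (tgt u), Cell v)]) (binary_linked e) (binary_dim u v).

Definition binary_scheme n : T gone n.+1 :=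
  @binary gone n tt tt erefl.

Lemma comp_shape n (u v : X n.+1) (e : tgt u = src v) :
  fmap T (gbang X) n.+1 (binary e) = ar L gone n.+1 (sp L (binary_scheme n)).
Proof. by rewrite ar_sp; apply: pasting_inj. Qed.

Definition comp_cell n (u v : X n.+1) (e : tgt u = src v) : X n.+1 :=
  str X n.+1 (pair_cell (comp_shape e)).

Definition Phi (S : forall n, X n -> Prop) n : X n -> Prop :=
  match n return X n -> Prop with
  | 0 => fun _ => False
  | m.+1 => fun u => exists (v : X m.+1) (huv : tgt u = src v) (hvu : tgt v = src u)
      (p q : X m.+2),
      [/\ src p = comp_cell huv, tgt p = id_cell (src u) & S m.+2 p] /\
      [/\ src q = comp_cell hvu, tgt q = id_cell (tgt u) & S m.+2 q]
  end.

(* The greatest fixed point of [Phi], as the union of its post-fixed points. *)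
Definition invertible n (u : X n) : Prop :=
  exists W : forall m, X m -> Prop, (forall m x, W m x -> Phi W x) /\ W n u.

Fixpoint hereditarily_invertible n : X n -> Prop :=
  match n return X n -> Prop with
  | 0 => fun _ => True
  | m.+1 => fun x => [/\ invertible x, hereditarily_invertible (src x)
                       & hereditarily_invertible (tgt x)]
  end.

Definition core_cell n := {x : X n | hereditarily_invertible x}.

Lemma core_src_proof n (x : core_cell n.+1) : hereditarily_invertible (src (sval x)).
Proof. by case: x => x []. Qed.

Lemma core_tgt_proof n (x : core_cell n.+1) : hereditarily_invertible (tgt (sval x)).
Proof. by case: x => x []. Qed.

Definition core_src n (x : core_cell n.+1) : core_cell n := exist _ _ (core_src_proof x).
Definition core_tgt n (x : core_cell n.+1) : core_cell n := exist _ _ (core_tgt_proof x).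

Lemma core_src_tgt n (x : core_cell n.+2) : core_src (core_src x) = core_src (core_tgt x).
Proof. by apply: eq_exist; rewrite /= src_tgt. Qed.

Lemma core_tgt_src n (x : core_cell n.+2) : core_tgt (core_src x) = core_tgt (core_tgt x).
Proof. by apply: eq_exist; rewrite /= tgt_src. Qed.

Definition core : globular_set := GlobularSet core_src_tgt core_tgt_src.

Definition core_incl : gmap core X :=
  @Gmap core X (fun _ x => sval x) (fun _ _ => erefl) (fun _ _ => erefl).

End WeakOmegaCategory.

(* Main.v *)
From mathcomp Require Import all_boot boolp zify.
Require Import Defs.

Set Implicit Arguments.
Unset Strict Implicit.
Unset Printing Implicit Defensive.

(** The main point is that a pasting [str (phi, u)] is invertible as soon as
    the entries of [u] of top dimension are ([invertible_str]).  Granted this,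
    hereditary invertibility of [str w] follows by induction on the dimension,
    because [str] commutes with sources and targets, and the core inherits the
    algebra laws of [X] because its inclusion is injective.

    Closure under pasting is proved by coinduction.  Let [pasted] be the least
    class of cells that contains the invertible ones and contains
    [str (phi, u)] whenever it contains the entries of [u] of top dimension.  As
    the invertible cells form the greatest post-fixed point of [Phi], it
    suffices that every pasted cell lies in [Phi pasted], and this can be
    shown by induction on the generation of [pasted]: assuming that each top
    entry of [u] has an inverse, with both cancellations witnessed by pasted
    cells, an inverse of [str (phi, u)] is constructed.

    Call two cells linkable when a pasted cell of the next dimension goes from
    one to the other.  The class [pasted] was made closed under pasting
    so that this relation is flexible.  The cells supplied by the contraction
    over a degenerate scheme have no top entries, hence are pasted: any two
    evaluations of one diagram with the same boundary in [L X] are linkable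
    ([over_linkable]).  Moreover a pasting diagram of pasted cells links the
    evaluations of its source and of its target ([linkable_pasting]), so
    linkability is transitive and compatible with composition.  Finally
    evaluating a diagram of diagrams in two stages or after gluing gives the
    same result ([over_subst], from the associativity law of the algebra).
    Up to linking one can thus calculate as in a strict omega-category, and
    having an inverse is transported along linkable cells
    ([inverse_linkable]).

    Cut an (n+1)-dimensional diagram [U] at its separators of dimension less
    than [n]: each block is then a chain of (n+1)-cells composable along
    n-cells, or a single cell of dimension at most [n].
    - A chain of cells with inverses has an inverse: compose the
      inverses backwards ([comp_cancels], [chain_inverse]).  By substitution
      every block may be collapsed to one cell ([paste_inverse]).
    - If each block is a single cell [u_i] or a low-dimensional cell, let [U']
      be the diagram in which each [u_i] is replaced by its inverse [v_i]
      ([fill_inverse]).  The blocks of the composite of [U] and [U'] are the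
      pairs [u_i], [v_i]; substitution turns them into the single cells
      [u_i * v_i], the cells from [u_i * v_i] to identities paste together
      into one cell, and identities disappear by substitution again, leaving
      the source of [U] ([fill_cancels]).  All cancellations are thus done in
      one step. *)

(** * Cells of the free algebra *)

Lemma gmap_ext (X Y : globular_set) (f g : gmap X Y) :
  (forall n x, f n x = g n x) -> f = g.
Proof.
case: f g => f fs ft [g gs gt] /= e.
have {}e : f = g.
  by apply: functional_extensionality_dep => n; apply: functional_extensionality_dep.
subst g; congr Gmap; exact: Prop_irrelevance.
Qed.

Lemma Cell_inj (X : globular_set) n (x y : X n) : Cell x = Cell y -> x = y.
Proof. exact: Eqdep_dec.inj_pair2_eq_dec PeanoNat.Nat.eq_dec _ _ _ _. Qed.

Section Pairs.
Variable L : contraction_monad.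
Implicit Types X Y : globular_set.

(** The pasting instruction underlying a cell of [L X]; together with the arity
    it determines the cell, by [L_ext]. *)
Definition instr X n (w : L X n) : L gone n := fmap L (gbang X) n w.

Lemma instr_src X n (w : L X n.+1) : instr (src w) = src (instr w).
Proof. exact: gmap_src. Qed.

Lemma instr_tgt X n (w : L X n.+1) : instr (tgt w) = tgt (instr w).
Proof. exact: gmap_tgt. Qed.

Lemma instr_fmap X Y (f : gmap X Y) n (w : L X n) : instr (fmap L f n w) = instr w.
Proof.
rewrite /instr -(fmap_comp (cm_is_monad L)); congr (fmap L _ n w).
exact: gmap_ext.
Qed.

Lemma ar_fmap X Y (f : gmap X Y) n (w : L X n) :
  ar L Y n (fmap L f n w) = fmap T f n (ar L X n w).
Proof. exact: (morphism_nat (ar_morphism L)). Qed.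

Lemma ar_instr X n (w : L X n) : ar L gone n (instr w) = fmap T (gbang X) n (ar L X n w).
Proof. exact: ar_fmap. Qed.

Lemma ar_eta X n (x : X n) : ar L X n (eta L X n x) = eta T X n x.
Proof. exact: (morphism_eta (ar_morphism L)). Qed.

Lemma instr_eta X n (x : X n) : instr (eta L X n x) = e_tilde L n.
Proof. exact: (eta_nat (cm_is_monad L)). Qed.

Section Ext.
Variable X : globular_set.

(** The universal property of the pullback [L X] speaks of maps of globular sets,
    not of cells.  The two projections from the globular set of pairs of cells with
    the same image are equal by uniqueness, which gives injectivity on cells. *)
Definition twin n := {p : L X n * L X n |
  instr p.1 = instr p.2 /\ ar L X n p.1 = ar L X n p.2}.

Lemma twin_src_proof n (p : twin n.+1) : instr (src (sval p).1) = instr (src (sval p).2)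
  /\ ar L X n (src (sval p).1) = ar L X n (src (sval p).2).
Proof. by case: (svalP p) => e1 e2; rewrite !instr_src !gmap_src e1 e2. Qed.

Lemma twin_tgt_proof n (p : twin n.+1) : instr (tgt (sval p).1) = instr (tgt (sval p).2)
  /\ ar L X n (tgt (sval p).1) = ar L X n (tgt (sval p).2).
Proof. by case: (svalP p) => e1 e2; rewrite !instr_tgt !gmap_tgt e1 e2. Qed.

Definition twin_src n (p : twin n.+1) : twin n :=
  exist _ (src (sval p).1, src (sval p).2) (twin_src_proof p).
Definition twin_tgt n (p : twin n.+1) : twin n :=
  exist _ (tgt (sval p).1, tgt (sval p).2) (twin_tgt_proof p).

Lemma twin_src_tgt n (p : twin n.+2) : twin_src (twin_src p) = twin_src (twin_tgt p).
Proof. by apply: eq_exist; rewrite /= !src_tgt. Qed.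

Lemma twin_tgt_src n (p : twin n.+2) : twin_tgt (twin_src p) = twin_tgt (twin_tgt p).
Proof. by apply: eq_exist; rewrite /= !tgt_src. Qed.

Definition twins : globular_set := GlobularSet twin_src_tgt twin_tgt_src.

Definition twin_fst : gmap twins (L X) :=
  @Gmap twins (L X) (fun _ p => (sval p).1) (fun _ _ => erefl) (fun _ _ => erefl).
Definition twin_snd : gmap twins (L X) :=
  @Gmap twins (L X) (fun _ p => (sval p).2) (fun _ _ => erefl) (fun _ _ => erefl).

Lemma L_ext n (w w' : L X n) :
  instr w = instr w' -> ar L X n w = ar L X n w' -> w = w'.
Proof.
move=> e1 e2; have [sq univ] := ar_cartesian L (gbang X).
have [l [_ uniq]] := univ twins (gcomp (fmap L (gbang X)) twin_fst)
  (gcomp (ar L X) twin_fst) (fun n z => sq n _).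
pose z : twins n := exist _ (w, w') (conj e1 e2).
rewrite (_ : w = twin_fst n z) // (_ : w' = twin_snd n z) //.
rewrite (uniq twin_fst) // (uniq twin_snd) // => k p; case: (svalP p) => h1 h2 /=.
  by rewrite -/(instr _) -h1.
by rewrite -h2.
Qed.

End Ext.

Lemma instr_pair X n phi (u : T X n) (e : fmap T (gbang X) n u = ar L gone n phi) :
  instr (pair_cell e) = phi.
Proof. by case: (svalP (cid (pair_exists e))). Qed.

Lemma ar_pair X n phi (u : T X n) (e : fmap T (gbang X) n u = ar L gone n phi) :
  ar L X n (pair_cell e) = u.
Proof. by case: (svalP (cid (pair_exists e))). Qed.

(** The form in which the contraction is used throughout: [kappa] fills the
    boundary of the instructions, and the pullback square pairs the result with [D]. *)
Lemma contraction_lift X n (x y : L X n) (D : T X n.+1) :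
  parallel x y -> src D = ar L X n x -> tgt D = ar L X n y ->
  exists w : L X n.+1, [/\ src w = x, tgt w = y & ar L X n.+1 w = D].
Proof.
move=> par_xy sD tD.
have par : parallel (instr x) (instr y).
  case: n x y D par_xy {sD tD} => [|n] x y D //= [e1 e2].
  by rewrite -!instr_src -!instr_tgt e1 e2.
have ha : ar L gone n (instr x) = src (fmap T (gbang X) n.+1 D).
  by rewrite ar_instr -sD gmap_src.
have hb : ar L gone n (instr y) = tgt (fmap T (gbang X) n.+1 D).
  by rewrite ar_instr -tD gmap_tgt.
have e := esym (kappa_ar par ha hb); exists (pair_cell e); split.
- by apply: L_ext; rewrite ?instr_src ?instr_pair ?kappa_src // gmap_src ar_pair.
- by apply: L_ext; rewrite ?instr_tgt ?instr_pair ?kappa_tgt // gmap_tgt ar_pair.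
- exact: ar_pair.
Qed.

(** Eliminates the match in the definition of [sp_sig], whose branches depend on
    the proof of the tested condition. *)
Lemma alt_match (P : Prop) (b b' : bool) (p : alt_spec P b b') A (f : P -> A)
    (g : ~~ b -> A) (Q : A -> Prop) :
  (forall h, b' -> Q (f h)) -> (forall h, ~~ b' -> Q (g h)) ->
  Q (match p with AltTrue h => f h | AltFalse h => g h end).
Proof. by case: p => h hf hg; [apply: hf|apply: hg]. Qed.

Lemma sp_unit n (k : T gone n) : is_unit_scheme k -> sp L k = e_tilde L n.
Proof.
case: n k => [|n] k // unit_k; rewrite /sp /=.
apply: (@alt_match _ _ _ _ _ _ _ (fun s => sval s = e_tilde L n.+1)) => // h.
by rewrite unit_k.
Qed.

Lemma sp_src_tgt n (k : T gone n.+1) : ~~ is_unit_scheme k ->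
  src (sp L k) = sp L (src k) /\ tgt (sp L k) = sp L (src k).
Proof.
move=> nunit_k; rewrite {1 3}/sp /=.
apply: (@alt_match _ _ _ _ _ _ _
  (fun s => src (sval s) = sp L (src k) /\ tgt (sval s) = sp L (src k))).
  by move=> h unit_k; rewrite unit_k in nunit_k.
by move=> h _ /=; rewrite kappa_src kappa_tgt.
Qed.

(** The standard instructions for binary composition and identities have unit
    boundaries; this is why their evaluations have the boundary of their
    argument on the nose. *)
Lemma sp_binary n : src (sp L (binary_scheme n)) = e_tilde L n /\
  tgt (sp L (binary_scheme n)) = e_tilde L n.
Proof.
have -> : e_tilde L n = sp L (src (binary_scheme n)).
  rewrite sp_unit // /is_unit_scheme (_ : tab _ = (@Cell gone n tt, [::])) /dim //=.
  by rewrite [LHS]table_srcE /= ltnn csrc_Cell.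
exact: sp_src_tgt.
Qed.

Lemma sp_id n : let k := single (tt : gone n) (leqnSn n) in
  src (sp L k) = e_tilde L n /\ tgt (sp L k) = e_tilde L n.
Proof.
move=> k; have -> : e_tilde L n = sp L (src k).
  rewrite sp_unit // /is_unit_scheme (_ : tab _ = (@Cell gone n tt, [::])) /dim //=.
  by rewrite [LHS]table_srcE /= csrc_id.
by apply: sp_src_tgt; rewrite /is_unit_scheme /= /dim /= neq_ltn ltnSn.
Qed.

End Pairs.

(** * Gluing blocks *)

Section Glue.
Variable X : globular_set.
Implicit Types (B C : table X) (Bs Cs : seq (cell X * table X)).

Lemma blocks_id m B : is_block m B -> blocks m B.1 B.2 = (B, [::]).
Proof.
move=> bB; have := @blocks_join _ m B [::]; rewrite join_nil; apply.
by rewrite /is_blocks bB.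
Qed.

Lemma table_comp_block m B C : is_block m B -> is_block m C ->
  table_comp m B C = block_comp m B C.
Proof. by move=> bB bC; rewrite /table_comp !blocks_id //= join_nil. Qed.

Lemma block_comp_cat m B C : m < dim B.1 -> m < dim C.1 ->
  block_comp m B C = (B.1, B.2 ++ (csrc m C.1, C.1) :: C.2).
Proof. by rewrite /block_comp !ltnNge => /negbTE -> /negbTE ->. Qed.

Lemma is_blockW m p B : p <= m -> is_block m B -> is_block p B.
Proof. by move=> le_pm; apply: sub_all => q; apply: leq_trans. Qed.

Lemma head_dim m k B : is_block m B -> linked B.1 B.2 -> k < m ->
  k < dim (last_entry B) -> k < dim B.1.
Proof.
case: B => u [|[a v] us] //= /andP[/= le_ma _] [lt_au _ _ _ _] lt_km _; lia.
Qed.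

(** [glue] only remembers the dimensions of the separators, since the separators
    themselves can be recovered from the first entries of the blocks. *)
Definition dims Bs : seq (nat * table X) := [seq (dim p.1, p.2) | p <- Bs].

(** One stage of gluing replaces the cut of a table at the separators of dimension
    at most [e] by its cut at those of dimension less than [e].  No identity is
    dropped, as every block starts with a cell of dimension above that of the
    neighbouring separators. *)
Lemma merge_join e B Bs : is_blocks e.+1 B Bs -> linked_blocks B Bs ->
  exists C Cs, [/\ merge e B (dims Bs) = (C, dims Cs), join (C, Cs) = join (B, Bs),
    is_blocks e C Cs & C.1 = B.1].
Proof.
elim: Bs B => [|[a B'] Bs IH] B.
  rewrite /is_blocks andbT => bB _; exists B, [::]; split=> //.
  by rewrite /is_blocks andbT; apply: is_blockW bB.
move=> /and3P[bB /andP[/= lt_ae bB'] bBs] [lB [d1 d2 t s lBs]].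
have bB'Bs : is_blocks e.+1 B' Bs by apply/andP.
have [C [Cs [-> eJ bC eC]]] := IH B' bB'Bs lBs.
case/andP: (bC) => bC1 bC2; have bBe := is_blockW (leqnSn e) bB.
case: eqP => [ea|nea].
  subst e; exists (block_comp (dim a) B C), Cs.
  have hB : dim a < dim B.1 := head_dim bB lB lt_ae d1.
  rewrite table_comp_block // block_comp_cat ?eC // s; split => //.
    by rewrite [in RHS](surjective_pairing B) join_cons -eJ /join /= -catA eC.
  rewrite /is_blocks bC2 andbT /is_block all_cat /= leqnn.
  by apply/andP.
exists B, ((a, C) :: Cs); split => //.
  by rewrite [B]surjective_pairing !join_cons eJ.
rewrite /is_blocks bBe /= bC1 bC2 !andbT; lia.
Qed.

Lemma glue_join d B Bs : is_blocks d B Bs -> linked_blocks B Bs ->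
  glue d B (dims Bs) = join (B, Bs).
Proof.
elim: d B Bs => [|d IH] B Bs /=.
  by case: Bs => [|[a C] Bs]; rewrite ?join_nil // /is_blocks /= andbF.
move=> bB lB; have [C [Cs [-> eJ bC _]]] := merge_join bB lB.
by rewrite IH ?eJ //; apply/linked_join; rewrite eJ; apply/linked_join.
Qed.

End Glue.

(** * Diagrams cut along low-dimensional cells *)

Lemma cell_map_id (X : globular_set) (c : cell X) : cell_map (gid X) c = c.
Proof. by case: c. Qed.

Section Fill.
Variables (X : globular_set) (E : Type).
Implicit Types D : E * seq (cell X * E).

(** The diagrams of interest below share their separators and differ in their
    top-row entries: a skeleton [D] carries abstract entries in [E], and each
    interpretation [F] of these as cells gives a table. *)
Definition fill (Y : globular_set) (f : gmap X Y) (F : E -> cell Y) D : table Y :=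
  (F D.1, [seq (cell_map f p.1, F p.2) | p <- D.2]).

Definition low_seps m D : bool := all (fun p => dim p.1 < m) D.2.

Lemma low_sepsW m n D : m <= n -> low_seps m D -> low_seps n D.
Proof. by move=> le_mn; apply: sub_all => p /leq_trans; apply. Qed.

Lemma fill_ext Y (f g : gmap X Y) (F G : E -> cell Y) D :
  (forall n x, f n x = g n x) -> F =1 G -> fill f F D = fill g G D.
Proof.
move=> /gmap_ext <- eFG; rewrite /fill eFG; congr pair.
by apply: eq_map => p; rewrite eFG.
Qed.

Lemma fill_map Y Z (f : gmap X Y) (g : gmap Y Z) (F : E -> cell Y) D :
  table_map g (fill f F D) = fill (gcomp g f) (fun e => cell_map g (F e)) D.
Proof. by rewrite /table_map /fill /= -map_comp. Qed.

Lemma fill_src Y (f : gmap X Y) (F : E -> cell Y) m D : low_seps m D ->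
  table_src m (fill f F D) = fill f (fun e => csrc m (F e)) D.
Proof.
case: D => e0 es; rewrite /low_seps table_srcE /= => lo; congr pair.
elim: es lo => [|[a e] es IH] //= /andP[lt_am /IH {}IH].
by rewrite -/(dim a) lt_am /= IH.
Qed.

Lemma fill_tgt Y (f : gmap X Y) (F : E -> cell Y) m D : low_seps m D ->
  table_tgt m (fill f F D) = fill f (fun e => ctgt m (F e)) D.
Proof.
case: D => e0 es; rewrite /low_seps /=; elim: es e0 => [|[a e] es IH] e0 //.
move=> /andP[/= lt_am lo]; rewrite /fill /= table_tgt_cons lt_am.
by rewrite [table_tgt _ _](IH e lo).
Qed.

(** Linkedness at a separator of dimension [k < m] concerns [k]-dimensional
    sources and targets, which a cell shares with its [m]-source. *)
Lemma fill_linked Y (f : gmap X Y) (F : E -> cell Y) (s : E -> cell X) m D :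
    low_seps m D -> let S := fill (gid X) s D in linked S.1 S.2 ->
    (forall e, csrc m (F e) = cell_map f (s e)) ->
  let U := fill f F D in linked U.1 U.2.
Proof.
case: D => e0 es; rewrite /low_seps /= => lo lS hF.
have dF e k : k < dim (s e) -> k < dim (F e).
  move=> lt_k; have := congr1 (@dim Y) (hF e).
  by rewrite dim_csrc /= /dim /= => hd; move: lt_k; rewrite /dim -hd; lia.
elim: es e0 lo lS => [|[a e] es IH] e0 //= /andP[lt_am lo].
rewrite !cell_map_id => -[lt0 lt1 t s0 /(IH _ lo) lE]; split => //.
- exact: dF.
- exact: dF.
- by rewrite -/(dim a) -(ctgt_csrc _ lt_am) hF ctgt_map t.
- by rewrite -/(dim a) -(csrc_csrc _ (ltnW lt_am)) hF csrc_map s0.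
Qed.

Lemma fill_dim_le Y (f : gmap X Y) (F : E -> cell Y) n D :
  (forall e, dim (F e) <= n) -> dim_le n (fill f F D).
Proof. by move=> le_F; rewrite /dim_le le_F /= all_map; elim: D.2 => //= p l ->; rewrite le_F. Qed.

Lemma blocks_fill (F : E -> cell X) m D : low_seps m D ->
  blocks m (fill (gid X) F D).1 (fill (gid X) F D).2 =
  ((F D.1, [::]), [seq (cell_map (gid X) p.1, (F p.2, [::])) | p <- D.2]).
Proof.
case: D => e0 es; rewrite /low_seps /=; elim: es e0 => [|[a e] es IH] e0 //=.
by move=> /andP[lt_am /(IH e) ->]; rewrite /dim /= -/(dim a) lt_am.
Qed.

Lemma fill_comp (F G : E -> cell X) m D : low_seps m D ->
  table_comp m (fill (gid X) F D) (fill (gid X) G D) =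
  join (block_comp m (F D.1, [::]) (G D.1, [::]),
        [seq (p.1, block_comp m (F p.2, [::]) (G p.2, [::])) | p <- D.2]).
Proof.
move=> lo; rewrite /table_comp !blocks_fill //=; congr (join (_, _)).
by elim: D.2 => [|[a e] es IH] //=; rewrite IH cell_map_id.
Qed.

Lemma src_singleton m (B : table X) s : table_src m B = (s, [::]) ->
  is_block m B /\ csrc m B.1 = s.
Proof.
case: B => u us; rewrite table_srcE => -[-> e]; split => //; rewrite /is_block /=.
by elim: us e => [|[a v] us IH] //=; case: ltnP => //= _ /IH.
Qed.

Lemma tgt_singleton m (B : table X) t : is_block m B -> table_tgt m B = (t, [::]) ->
  ctgt m (last_entry B) = t.
Proof. by move=> bB; rewrite /table_tgt blocks_id //= => -[]. Qed.

Lemma merge_noop d U (Us : seq (nat * table X)) : all (fun p => p.1 < d) Us ->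
  merge d U Us = (U, Us).
Proof.
elim: Us U => [|[k V] Us IH] U //= /andP[lt_kd /IH ->].
by rewrite ltn_eqF.
Qed.

(** The one-entry [m]-boundaries force each [G e] to be a block, with the same
    lower boundary as its [m]-source, so that [glue_join] applies. *)
Lemma glue_fill (G : E -> table X) (s t : E -> cell X) m D : low_seps m D ->
    let S := fill (gid X) s D in linked S.1 S.2 ->
    let V := fill (gid X) t D in linked V.1 V.2 ->
    (forall e, linked (G e).1 (G e).2) ->
    (forall e, table_src m (G e) = (s e, [::])) ->
    (forall e, table_tgt m (G e) = (t e, [::])) ->
  glue m.+1 (G D.1) [seq (dim p.1, G p.2) | p <- D.2] =
  join (G D.1, [seq (p.1, G p.2) | p <- D.2]).
Proof.
case: D => e0 es; rewrite /low_seps /= => lo lS lT lG sG tG.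
have bG e : is_block m (G e) by case: (src_singleton (sG e)).
rewrite merge_noop ?all_map //=.
rewrite (_ : [seq _ | p <- es] = dims [seq (p.1, G p.2) | p <- es]); last first.
  by rewrite /dims -map_comp.
rewrite glue_join //.
  rewrite /is_blocks bG /= all_map; apply: sub_all lo => p /= ->.
  exact: bG.
have cs e : csrc m (G e).1 = s e by case: (src_singleton (sG e)).
have ct e : ctgt m (last_entry (G e)) = t e := tgt_singleton (bG e) (tG e).
elim: es e0 lo lS lT => [|[a e] es IH] e0 //=.
case/andP=> lt_am lo; rewrite -/(dim a) !cell_map_id => -[d1 d2 t1 s1 l1] [d3 d4 t2 s2 l2].
split; first exact: lG.
split; last exact: IH.
- by move: d3; rewrite -ct dim_ctgt; lia.
- by move: d2; rewrite -cs dim_csrc; lia.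
- by rewrite -t2 -{2}ct ctgt_ctgt ?t2 // ltnW.
- by rewrite -s1 -{2}cs csrc_csrc ?s1 // ltnW.
Qed.

End Fill.

(** * Evaluating pasting diagrams, up to linking cells *)

Lemma table_tgt1 (X : globular_set) m (u : cell X) :
  table_tgt m (u, [::]) = (ctgt m u, [::]).
Proof. by []. Qed.

Section PairShapes.
Variables (L : contraction_monad) (Y : globular_set).

Lemma pair_binary n (u v : Y n.+1) (e : tgt u = src v)
    (h : fmap T (gbang Y) n.+1 (binary e) = ar L gone n.+1 (sp L (binary_scheme n))) :
  src (pair_cell h) = eta L Y n (src u) /\ tgt (pair_cell h) = eta L Y n (tgt v).
Proof.
have [s t] := sp_binary L n; split; apply: L_ext.
- by rewrite instr_src instr_pair s instr_eta.
- rewrite gmap_src ar_pair ar_eta; apply: pasting_inj.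
  by rewrite [LHS]table_srcE /= ltnn csrc_Cell.
- by rewrite instr_tgt instr_pair t instr_eta.
- rewrite gmap_tgt ar_pair ar_eta; apply: pasting_inj.
  by rewrite [LHS]table_tgt_cons /= ltnn /table_tgt /= /last_entry /= ctgt_Cell.
Qed.

Lemma pair_single n (x : Y n)
    (h : fmap T (gbang Y) n.+1 (single x (leqnSn n)) =
         ar L gone n.+1 (sp L (single (tt : gone n) (leqnSn n)))) :
  src (pair_cell h) = eta L Y n x /\ tgt (pair_cell h) = eta L Y n x.
Proof.
have [s t] := sp_id L n; split; apply: L_ext.
- by rewrite instr_src instr_pair s instr_eta.
- rewrite gmap_src ar_pair ar_eta; apply: pasting_inj.
  by rewrite [LHS]table_srcE /= csrc_id.
- by rewrite instr_tgt instr_pair t instr_eta.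
- rewrite gmap_tgt ar_pair ar_eta; apply: pasting_inj.
  by rewrite [LHS]table_tgt1 ctgt_id.
Qed.

Lemma binary_shape n (u v : Y n.+1) (e : tgt u = src v) :
  fmap T (gbang Y) n.+1 (binary e) = ar L gone n.+1 (sp L (binary_scheme n)).
Proof. by rewrite ar_sp; apply: pasting_inj. Qed.

Lemma single_shape n (x : Y n) : fmap T (gbang Y) n.+1 (single x (leqnSn n)) =
  ar L gone n.+1 (sp L (single (tt : gone n) (leqnSn n))).
Proof. by rewrite ar_sp; apply: pasting_inj. Qed.

End PairShapes.

Lemma glue_nil (X : globular_set) d (U : table X) : glue d U [::] = U.
Proof. by elim: d. Qed.

Section Algebra.
Variables (L : contraction_monad) (X : algebra L).

Definition tops (Y : globular_set) (U : table Y) : seq (cell Y) := U.1 :: unzip2 U.2.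

Lemma tops_dim n (U : table X) c : dim_le n U -> List.In c (tops U) -> dim c <= n.
Proof.
case: U => u us /andP[/= le_u le_us] [<- //|].
elim: us le_us => [|[a v] us IH] //= /andP[le_v /IH h] [<- //|]; exact: h.
Qed.

(** The coinduction invariant.  No condition is put on the entries of
    lower dimension, so that coherence cells are pasted. *)
Inductive pasted : forall n, X n -> Prop :=
| pasted_invertible n (x : X n) : invertible x -> pasted x
| pasted_str n (w : L X n.+1) :
    (forall x : X n.+1, List.In (Cell x) (tops (tab (ar L X n.+1 w))) -> pasted x) ->
    pasted (str X n.+1 w).

Definition linkable n (x y : X n) : Prop :=
  exists z : X n.+1, [/\ src z = x, tgt z = y & pasted z].

(** The cell [c] is an evaluation of the diagram [D].  The boundary is
    recorded in [L X] rather than in [X], because two evaluations of one diagram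
    are linkable when these boundaries agree. *)
Definition over n (x y : L X n) (D : table X) (c : X n.+1) : Prop :=
  exists w : L X n.+1, [/\ src w = x, tgt w = y, tab (ar L X n.+1 w) = D & str X n.+1 w = c].

(** The contraction provides an instruction for [P] between the instructions of [w]
    and [w']. *)
Lemma linkable_pasting n (w w' : L X n) (P : T X n.+1) :
    parallel w w' -> src P = ar L X n w -> tgt P = ar L X n w' ->
    (forall x : X n.+1, List.In (Cell x) (tops (tab P)) -> pasted x) ->
  linkable (str X n w) (str X n w').
Proof.
move=> par sP tP hP; have [z [sz tz arz]] := contraction_lift par sP tP.
exists (str X n.+1 z); split; rewrite -?gmap_src -?gmap_tgt ?sz ?tz //.
by apply: pasted_str; rewrite arz.
Qed.

(** The diagram [ar w], viewed as degenerate one dimension up, has no entry of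
    top dimension. *)
Lemma coherence n (w w' : L X n) : parallel w w' -> ar L X n w = ar L X n w' ->
  linkable (str X n w) (str X n w').
Proof.
move=> par e; pose D := ar L X n w.
pose P : T X n.+1 := Pasting (tab_linked D) (dim_le_trans (leqnSn n) (tab_dim D)).
apply: (linkable_pasting (P := P)) => //.
- by apply: pasting_inj; rewrite /= table_src_id //; [apply: tab_linked|apply: tab_dim].
- by rewrite -e; apply: pasting_inj; rewrite /= table_tgt_id //; [apply: tab_linked|apply: tab_dim].
- by move=> x /(tops_dim (tab_dim D)); rewrite /dim /= ltnn.
Qed.

Lemma over_linkable n (x y : L X n) D c c' : over x y D c -> over x y D c' -> linkable c c'.
Proof.
move=> [w [<- <- <- <-]] [w' [s t e <-]]; apply: coherence; first by rewrite /= s t.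
by apply: pasting_inj; rewrite e.
Qed.

Lemma eta_str n (x : X n) : str X n (eta L X n x) = x.
Proof. exact: (algebra_eta (str_is_algebra X)). Qed.

Lemma str_eta_cell (c : cell X) : cell_map (str X) (cell_map (eta L X) c) = c.
Proof. by case: c => k x; rewrite /cell_map /= eta_str. Qed.

Lemma linkable_refl n (x : X n) : linkable x x.
Proof. by rewrite -(eta_str x); apply: coherence => //; apply: parallel_refl. Qed.

Lemma over_cell n (u : X n.+1) : over (eta L X n (src u)) (eta L X n (tgt u)) (Cell u, [::]) u.
Proof. by exists (eta L X n.+1 u); rewrite -gmap_src -gmap_tgt eta_str ar_eta. Qed.

Lemma over_src n (x y : L X n) D c : over x y D c -> src c = str X n x.
Proof. by case=> w [<- _ _ <-]; rewrite gmap_src. Qed.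

Lemma over_tgt n (x y : L X n) D c : over x y D c -> tgt c = str X n y.
Proof. by case=> w [_ <- _ <-]; rewrite gmap_tgt. Qed.

Lemma over_exists n (x y : L X n) (D : table X) :
    parallel x y -> linked D.1 D.2 -> dim_le n.+1 D ->
    table_src n D = tab (ar L X n x) -> table_tgt n D = tab (ar L X n y) ->
  exists c, over x y D c.
Proof.
move=> par lD dD sD tD; pose P : T X n.+1 := Pasting lD dD.
have [||w [sw tw arw]] := contraction_lift (D := P) par; try exact: pasting_inj.
by exists (str X n.+1 w), w; rewrite arw.
Qed.

Lemma ar_mu n (W : L (L X) n) :
  ar L X n (mu L X n W) = T_mult_fun (fmap T (ar L X) n (ar L (L X) n W)).
Proof. exact: (morphism_mu (ar_morphism L)). Qed.

Lemma str_mu n (W : L (L X) n) : str X n (mu L X n W) = str X n (fmap L (str X) n W).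
Proof. exact: (algebra_mu (str_is_algebra X)). Qed.

Lemma mu_unit n (w : L X n) : mu L X n (eta L (L X) n w) = w.
Proof. exact: (mu_eta (cm_is_monad L)). Qed.

(** Binary composition is the evaluation of a diagram of length two in [L X],
    which the associativity law rewrites as an evaluation of the glued diagram. *)
Lemma over_comp n (x y z : L X n) D E c d (e : tgt c = src d) :
  over x y D c -> over y z E d -> over x z (table_comp n D E) (comp_cell e).
Proof.
move=> [w [sw tw <- ec]] [w' [sw' tw' <- ed]].
have ew : tgt w = src w' by rewrite tw sw'.
have [sW tW] := pair_binary (binary_shape L ew).
exists (mu L X n.+1 (pair_cell (binary_shape L ew))); split.
- by rewrite -gmap_src sW mu_unit.
- by rewrite -gmap_tgt tW mu_unit.
- by rewrite ar_mu ar_pair /= /inners /= eqxx glue_nil.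
- rewrite str_mu; congr (str X _ _); apply: L_ext; rewrite ?instr_fmap ?instr_pair //.
  rewrite ar_fmap !ar_pair; apply: pasting_inj.
  by rewrite /= /table_map /cell_map /= gmap_tgt ec ed.
Qed.

Lemma over_id n (x : L X n) : over x x (tab (ar L X n x)) (id_cell (str X n x)).
Proof.
have [sW tW] := pair_single (single_shape L x).
exists (mu L X n.+1 (pair_cell (single_shape L x))); split.
- by rewrite -gmap_src sW mu_unit.
- by rewrite -gmap_tgt tW mu_unit.
- by rewrite ar_mu ar_pair /= /inners /= glue_nil.
- rewrite str_mu; congr (str X _ _); apply: L_ext; rewrite ?instr_fmap ?instr_pair //.
  by rewrite ar_fmap !ar_pair; apply: pasting_inj.
Qed.

(** Two-stage evaluation: [V] is a diagram of evaluated diagrams, and evaluating it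
    entrywise first is the same as evaluating the glued diagram.  The
    boundary of [V] consists of units, so the boundary in [L X] is not changed
    by the multiplication. *)
Lemma over_subst n (V : T (L X) n.+1) (S S' : T X n) (x y : L X n) c :
    src V = fmap T (eta L X) n S -> tgt V = fmap T (eta L X) n S' ->
    over x y (tab (fmap T (str X) n.+1 V)) c ->
  over x y (tab (T_mult_fun (fmap T (ar L X) n.+1 V))) c.
Proof.
move=> sV tV [w [<- <- arw <-]].
have {}arw : ar L X n.+1 w = fmap T (str X) n.+1 V by apply: pasting_inj.
have str_etaT m (D : T X m) : fmap T (str X) m (fmap T (eta L X) m D) = D.
  apply: pasting_inj; rewrite /=; case: (tab D) => u us; rewrite /table_map /=.
  rewrite str_eta_cell -map_comp; congr pair; rewrite -[RHS]map_id.
  by apply: eq_map => -[a b] /=; rewrite !str_eta_cell.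
have eh : fmap T (gbang (L X)) n.+1 V = ar L gone n.+1 (instr w).
  rewrite ar_instr arw; apply: pasting_inj.
  by rewrite /= /table_map /= -map_comp.
have eW : fmap L (str X) n.+1 (pair_cell eh) = w.
  by apply: L_ext; rewrite ?instr_fmap ?instr_pair // ar_fmap ar_pair arw.
exists (mu L X n.+1 (pair_cell eh)); split.
- rewrite -gmap_src (_ : src _ = fmap L (eta L X) n (src w)).
    exact: (mu_fmap_eta (cm_is_monad L)).
  apply: L_ext; first by rewrite instr_src instr_pair instr_fmap instr_src.
  by rewrite gmap_src ar_pair ar_fmap gmap_src arw -gmap_src sV str_etaT.
- rewrite -gmap_tgt (_ : tgt _ = fmap L (eta L X) n (tgt w)).
    exact: (mu_fmap_eta (cm_is_monad L)).
  apply: L_ext; first by rewrite instr_tgt instr_pair instr_fmap instr_tgt.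
  by rewrite gmap_tgt ar_pair ar_fmap gmap_tgt arw -gmap_tgt tV str_etaT.
- by rewrite ar_mu ar_pair.
- by rewrite str_mu eW.
Qed.

End Algebra.

(** * Calculus of one-sided inverses *)

Section Inverses.
Variables (L : contraction_monad) (X : algebra L).

Lemma src_comp n (u v : X n.+1) (e : tgt u = src v) : src (comp_cell e) = src u.
Proof.
rewrite /comp_cell -gmap_src; case: (pair_binary (comp_shape e)) => -> _.
exact: eta_str.
Qed.

Lemma tgt_comp n (u v : X n.+1) (e : tgt u = src v) : tgt (comp_cell e) = tgt v.
Proof.
rewrite /comp_cell -gmap_tgt; case: (pair_binary (comp_shape e)) => _ ->.
exact: eta_str.
Qed.

Lemma tgt_id n (x : X n) : tgt (id_cell x) = x.
Proof. by rewrite /id_cell -gmap_tgt; case: (pair_single (id_shape x)) => _ ->; apply: eta_str. Qed.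

Lemma linkable_parallel n (x y : X n) : linkable x y -> parallel x y.
Proof.
case: n x y => [|n] x y // [z [<- <- _]].
by split; [apply: src_tgt|apply: tgt_src].
Qed.

Lemma linkable_trans n (x y z : X n) : linkable x y -> linkable y z -> linkable x z.
Proof.
move=> [p [sp tp hp]] [q [sq tq hq]]; have e : tgt p = src q by rewrite tp sq.
exists (comp_cell e); split; rewrite ?src_comp ?tgt_comp //.
apply: pasted_str => t; rewrite ar_pair /=.
by case=> [/Cell_inj <- //|[/Cell_inj <- //|[]]].
Qed.

(** Paste the two linking cells along the common boundary of dimension [n]. *)
Lemma comp_linkable n (c c' d d' : X n.+1) (e : tgt c = src d) (e' : tgt c' = src d') :
  linkable c c' -> linkable d d' -> linkable (comp_cell e) (comp_cell e').
Proof.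
move=> cc' dd'; have [s1 t1] := linkable_parallel cc'; have [s2 t2] := linkable_parallel dd'.
case: cc' dd' => [p [sp tp hp]] [q [sq tq hq]].
have [sw tw] := pair_binary (comp_shape e); have [sw' tw'] := pair_binary (comp_shape e').
have lP : linked (Cell p) [:: (Cell (tgt c), Cell q)].
  split=> //=.
  - by rewrite -(ctgt_ctgt _ (leqnSn n)) ctgt_Cell tp ctgt_Cell /= t1.
  - by rewrite -(csrc_csrc _ (leqnSn n)) csrc_Cell sq csrc_Cell /= e.
have dP : dim_le n.+2 (Cell p, [:: (Cell (tgt c), Cell q)]) by rewrite /dim_le /= /dim /= leqnn.
apply: (@linkable_pasting L X n.+1 (pair_cell (comp_shape e)) (pair_cell (comp_shape e'))
  (@Pasting X n.+2 (Cell p, [:: (Cell (tgt c), Cell q)]) lP dP)).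
- by rewrite /= sw sw' tw tw' s1 t2.
- rewrite ar_pair; apply: pasting_inj.
  by rewrite [LHS]table_srcE /= leqnn /= !csrc_Cell sp sq.
- rewrite ar_pair; apply: pasting_inj.
  by rewrite [LHS]table_tgt_cons ifT // !table_tgt1 !ctgt_Cell /= tp tq t1.
- by move=> t /=; case=> [/Cell_inj <- //|[/Cell_inj <- //|[]]].
Qed.

Definition cancels n (u v : X n.+1) : Prop :=
  exists e : tgt u = src v, linkable (comp_cell e) (id_cell (src u)).

Definition has_inverse n (u : X n.+1) : Prop := exists v, cancels u v /\ cancels v u.

Lemma cancels_tgt n (u v : X n.+1) : cancels u v -> tgt v = src u.
Proof. by case=> e /linkable_parallel[_]; rewrite tgt_comp tgt_id. Qed.

(** Both halves of [has_inverse] have the same form, so that each construction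
    of an inverse needs only one cancellation to be checked. *)
Lemma PhiE n (u : X n.+1) : Phi (@pasted L X) u <-> has_inverse u.
Proof.
split.
  move=> [v [huv [hvu [p [q [[sp tp hp] [sq tq hq]]]]]]]; exists v.
  by split; [exists huv; exists p | exists hvu; exists q; rewrite -huv].
move=> [v [[huv [p [sp tp hp]]] [hvu [q [sq tq hq]]]]].
by exists v, huv, hvu, p, q; split => //; split=> //; rewrite huv.
Qed.

Lemma cancelsl n (c d v : X n.+1) : linkable c d -> cancels d v -> cancels c v.
Proof.
move=> cd [e h]; have [s t] := linkable_parallel cd.
have e' : tgt c = src v by rewrite t.
exists e'; apply: linkable_trans (comp_linkable e' e cd (linkable_refl v)) _.
by rewrite s.
Qed.

Lemma cancelsr n (c d v : X n.+1) : linkable c d -> cancels v d -> cancels v c.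
Proof.
move=> cd [e h]; have [s t] := linkable_parallel cd.
have e' : tgt v = src c by rewrite s.
by exists e'; apply: linkable_trans (comp_linkable e' e (linkable_refl v) cd) _.
Qed.

Lemma inverse_linkable n (c d : X n.+1) : linkable c d -> has_inverse d -> has_inverse c.
Proof.
move=> cd [v [h1 h2]]; exists v; split; first exact: cancelsl cd h1.
exact: cancelsr cd h2.
Qed.

Lemma table_comp_cons n (u : cell X) (V : table X) : n < dim u -> n < dim V.1 ->
  is_block n V -> table_comp n (u, [::]) V = (u, (csrc n V.1, V.1) :: V.2).
Proof. by move=> du dV bV; rewrite table_comp_block // block_comp_cat. Qed.

(** As a table of dimension [n.+1], the left unit has dimension at most [n] and is
    dropped by composition. *)
Lemma unitl n (u : X n.+1) (e : tgt (id_cell (src u)) = src u) :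
  linkable (comp_cell e) u.
Proof.
have O1 := over_id (eta L X n (src u)); rewrite eta_str ar_eta /= in O1.
have := over_comp e O1 (over_cell u).
rewrite table_comp_block // /block_comp /= leqnn => h.
exact: over_linkable h (over_cell u).
Qed.

(** Both [(a * b) * (b' * a')] and [a * ((b * b') * a')] evaluate the chain of the
    four cells; in the latter, first [b * b'] and then [a * a'] cancel. *)
Lemma comp_cancels n (a b a' b' : X n.+1) (e : tgt a = src b) (e' : tgt b' = src a') :
  cancels a a' -> cancels b b' -> cancels (comp_cell e) (comp_cell e').
Proof.
move=> haa' hbb'; have ta' := cancels_tgt haa'; have tb' := cancels_tgt hbb'.
case: haa' => eaa' la; case: hbb' => ebb' lb.
have e1 : tgt (comp_cell e) = src (comp_cell e') by rewrite tgt_comp src_comp.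
exists e1; have e2 : tgt (comp_cell ebb') = src a' by rewrite tgt_comp.
have e3 : tgt a = src (comp_cell e2) by rewrite !src_comp.
have e5 : src a' = src b by rewrite -e' tb'.
have Oc (u : X n.+1) x y : src u = x -> tgt u = y ->
    over (eta L X n x) (eta L X n y) (Cell u, [::]) u.
  by move=> <- <-; apply: over_cell.
have Oa := Oc a _ _ erefl e; have Ob := Oc b _ _ erefl erefl.
have Ob' := Oc b' _ _ (esym ebb') tb'; have Oa' := Oc a' _ _ e5 ta'.
apply: (@linkable_trans _ _ (comp_cell e3)).
  have := over_comp e3 Oa (over_comp e2 (over_comp ebb' Ob Ob') Oa').
  have := over_comp e1 (over_comp e Oa Ob) (over_comp e' Ob' Oa').
  have cb (u v : cell X) us vs : n < dim u -> n < dim v ->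
      block_comp n (u, us) (v, vs) = (u, us ++ (csrc n v, v) :: vs).
    by move=> du dv; rewrite block_comp_cat.
  have bl (u v : cell X) us vs : is_block n (u, us) -> is_block n (v, vs) ->
      n < dim u -> n < dim v -> is_block n (u, us ++ (csrc n v, v) :: vs).
    move=> bu bv du dv; rewrite /is_block all_cat /= -/(dim (csrc n v)) dim_csrc.
    by apply/and3P; split=> //; lia.
  (* Both tables compute to the chain of [a], [b], [b'], [a']. *)
  rewrite !(table_comp_block, cb, bl) //.
  exact: over_linkable.
apply: (@linkable_trans _ _ (comp_cell eaa')); last by rewrite src_comp.
apply: comp_linkable (linkable_refl a) _.
apply: (@linkable_trans _ _ (comp_cell (tgt_id (src a')))); last exact: unitl.
apply: comp_linkable (linkable_refl a').
by rewrite e5.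
Qed.

Lemma comp_inverse n (a b : X n.+1) (e : tgt a = src b) :
  has_inverse a -> has_inverse b -> has_inverse (comp_cell e).
Proof.
move=> [a' [h1 h2]] [b' [h3 h4]].
have e' : tgt b' = src a' by rewrite (cancels_tgt h3) -e; case: h1.
by exists (comp_cell e'); split; apply: comp_cancels.
Qed.

Lemma block_src (Y : globular_set) m (B : table Y) : is_block m B ->
  table_src m B = (csrc m B.1, [::]).
Proof.
case: B => u us; rewrite table_srcE /is_block /=; elim: us => [|[a v] us IH] //=.
by case/andP=> le_ma /IH; rewrite ltnNge le_ma.
Qed.

Lemma parallel_src_tgt (Y : globular_set) n (c : Y n.+1) : parallel (src c) (tgt c).
Proof. by case: n c => [|n] c //=; rewrite src_tgt tgt_src. Qed.

Lemma parallel_sym (Y : globular_set) n (x y : Y n) : parallel x y -> parallel y x.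
Proof. by case: n x y => [|n] x y //= [-> ->]. Qed.

Lemma parallel_trans (Y : globular_set) n (x y z : Y n) :
  parallel x y -> parallel y z -> parallel x z.
Proof. by case: n x y z => [|n] x y z //= [-> ->] [-> ->]. Qed.

Lemma parallel_map (Y Z : globular_set) (f : gmap Y Z) n (x y : Y n) :
  parallel x y -> parallel (f n x) (f n y).
Proof. by case: n x y => [|n] x y //= [e1 e2]; rewrite -!gmap_src -!gmap_tgt e1 e2. Qed.

Lemma cell_of_dim (Y : globular_set) n (c : cell Y) : dim c = n -> exists u : Y n, c = Cell u.
Proof. by case: c => k u /= <-; exists u. Qed.

Lemma over_table_src n (x y : L X n) U c : over x y U c ->
  table_src n U = tab (ar L X n x).
Proof. by case=> w [<- _ <- _]; rewrite gmap_src. Qed.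

Lemma over_table_tgt n (x y : L X n) U c : over x y U c ->
  table_tgt n U = tab (ar L X n y).
Proof. by case=> w [_ <- <- _]; rewrite gmap_tgt. Qed.

(** The evaluation of a chain is linkable to the composite of its first cell with an
    evaluation of the rest. *)
Lemma chain_inverse n (u : cell X) us (x y : X n) c :
    linked u us -> is_block n (u, us) -> dim_le n.+1 (u, us) -> n < dim u ->
    (forall t : X n.+1, List.In (Cell t) (tops (u, us)) -> has_inverse t) ->
  over (eta L X n x) (eta L X n y) (u, us) c -> has_inverse c.
Proof.
elim: us u x c => [|[a v] us IH] u x c lu bu dU lt_nu hU Oc.
  have [|u' eu] := @cell_of_dim X n.+1 u; first by case/andP: dU => /= ? _; lia.
  subst u; have := over_table_src Oc; have := over_table_tgt Oc.
  rewrite !ar_eta table_srcE table_tgt1 csrc_Cell ctgt_Cell => -[/Cell_inj ty] [/Cell_inj sx].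
  apply: (@inverse_linkable _ _ u'); last by apply: hU; left.
  by apply: over_linkable Oc _; rewrite -sx -ty; apply: over_cell.
have [|u' eu] := @cell_of_dim X n.+1 u; first by case/andP: dU => /= ? _; lia.
subst u; have hu : has_inverse u' by apply: hU; left.
have := over_table_src Oc; rewrite ar_eta block_src //= csrc_Cell => -[/Cell_inj ex].
case: lu => lt_au lt_av tu sv lv.
case/andP: (bu) => /= le_na bv; case/and3P: (dU) => /= le_u le_v le_us.
have da : dim a = n by move: lt_au; rewrite [dim (Cell _)]/dim /=; lia.
rewrite da in sv tu; have ea : a = Cell (tgt u') by rewrite -tu ctgt_Cell.
have dV : dim_le n.+1 (v, us) by apply/andP.
have sV : table_src n (v, us) = (Cell (tgt u'), [::]) by rewrite block_src //= sv ea.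
have tV : table_tgt n (v, us) = (Cell y, [::]).
  by have := over_table_tgt Oc; rewrite ar_eta table_tgt_cons da ltnn.
have par : parallel (tgt u') y.
  apply: parallel_trans (parallel_sym (parallel_src_tgt u')) _.
  have <- : tgt c = y by rewrite (over_tgt Oc) eta_str.
  have -> : src u' = src c by rewrite (over_src Oc) eta_str ex.
  exact: parallel_src_tgt.
have [|||||d Od] := @over_exists L X n (eta L X n (tgt u')) (eta L X n y) (v, us) => //.
- exact: parallel_map.
- by rewrite sV ar_eta.
- by rewrite tV ar_eta.
have hd : has_inverse d.
  apply: (IH v (tgt u') d) => //; first by lia.
  by move=> t ht; apply: hU; right.
have e : tgt u' = src d by rewrite (over_src Od) eta_str.
apply: inverse_linkable (comp_inverse e hu hd).
have := over_comp e (over_cell u') Od; rewrite ex.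
rewrite table_comp_cons //=; last by lia.
by rewrite sv => /(over_linkable Oc).
Qed.

End Inverses.

(** * Substituting and cancelling simultaneously *)

Section Fillings.
Variables (L : contraction_monad) (X : algebra L).

Definition arity_table (h : cell (L X)) : table X := inner (cell_map (ar L X) h).

Lemma arity_src m h : arity_table (csrc m h) = table_src m (arity_table h).
Proof. by rewrite /arity_table -csrc_map inner_csrc. Qed.

Lemma arity_tgt m h : arity_table (ctgt m h) = table_tgt m (arity_table h).
Proof. by rewrite /arity_table -ctgt_map inner_ctgt. Qed.

Lemma arity_eta c : arity_table (cell_map (eta L X) c) = (c, [::]).
Proof. by case: c => k x; rewrite /arity_table /inner /= ar_eta. Qed.

Section Subst.
Variables (E : Type) (n : nat) (h : E -> cell (L X)) (s t : E -> cell X).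
Variable D : E * seq (cell X * E).
Hypothesis loD : low_seps n D.
Hypothesis dim_h : forall e, dim (h e) <= n.+1.
Hypothesis src_h : forall e, csrc n (h e) = cell_map (eta L X) (s e).
Hypothesis tgt_h : forall e, ctgt n (h e) = cell_map (eta L X) (t e).
Hypothesis linked_s : linked (fill (gid X) s D).1 (fill (gid X) s D).2.
Hypothesis linked_t : linked (fill (gid X) t D).1 (fill (gid X) t D).2.

Lemma dim_le_s : dim_le n (fill (gid X) s D).
Proof.
apply: fill_dim_le => e; have := congr1 (@dim _) (src_h e).
by rewrite dim_csrc [RHS]/dim /= -/(dim (s e)); lia.
Qed.

Lemma dim_le_t : dim_le n (fill (gid X) t D).
Proof.
apply: fill_dim_le => e; have := congr1 (@dim _) (tgt_h e).
by rewrite dim_ctgt [RHS]/dim /= -/(dim (t e)); lia.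
Qed.

(** [over_subst] for a skeleton whose entries are evaluated diagrams [h e]:
    gluing concatenates the diagrams. *)
Lemma over_fill (x y : L X n) c :
  over x y (fill (gid X) (fun e => cell_map (str X) (h e)) D) c ->
  over x y (join (arity_table (h D.1), [seq (p.1, arity_table (h p.2)) | p <- D.2])) c.
Proof.
have lV := fill_linked (f := eta L X) (F := h) loD linked_s src_h.
pose V : T (L X) n.+1 :=
  @Pasting (L X) n.+1 (fill (eta L X) h D) lV (fill_dim_le _ _ dim_h).
pose S : T X n := @Pasting X n (fill (gid X) s D) linked_s dim_le_s.
pose S' : T X n := @Pasting X n (fill (gid X) t D) linked_t dim_le_t.
have eS (r : E -> cell X) : table_map (eta L X) (fill (gid X) r D) =
    fill (eta L X) (fun e => cell_map (eta L X) (r e)) D.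
  by rewrite fill_map; apply: fill_ext.
have sV : src V = fmap T (eta L X) n S.
  apply: pasting_inj; rewrite /= fill_src // eS.
  by apply: fill_ext.
have tV : tgt V = fmap T (eta L X) n S'.
  apply: pasting_inj; rewrite /= fill_tgt // eS.
  by apply: fill_ext.
have eV : tab (fmap T (str X) n.+1 V) = fill (gid X) (fun e => cell_map (str X) (h e)) D.
  rewrite /= fill_map; apply: fill_ext => // k z /=; exact: eta_str.
rewrite -eV => /(over_subst sV tV).
have lG e : linked (arity_table (h e)).1 (arity_table (h e)).2 by apply: tab_linked.
rewrite -(glue_fill loD linked_s linked_t lG).
- by rewrite /= /inners /= -!map_comp.
- by move=> e; rewrite -arity_src src_h arity_eta.
- by move=> e; rewrite -arity_tgt tgt_h arity_eta.
Qed.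

End Subst.

Section Loops.
Variable n : nat.

(** Entries of a diagram in which every cell of dimension [n.+1] comes with an
    inverse.  The interpretations below keep the cells of dimension at most [n],
    or take their units in [L X].  The interpretations other than
    [loop_there] and [loop_back] have equal [n]-source and [n]-target, given by
    [loop_base]: this is what makes the entries of all of them fit together. *)
Inductive loop :=
| Low (c : cell X) of dim c <= n
| Loop (u v : X n.+1) of cancels u v & cancels v u.

Definition loop_swap (l : loop) : loop :=
  match l with Low c h => Low h | Loop u v h1 h2 => Loop h2 h1 end.

Lemma cancels_comp (u v : X n.+1) : cancels u v -> tgt u = src v.
Proof. by case. Qed.

Lemma cancels_fill (u v : X n.+1) (h : cancels u v) :
  linkable (comp_cell (cancels_comp h)) (id_cell (src u)).
Proof.
by have [e he] := h; rewrite (Prop_irrelevance (cancels_comp h) e).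
Qed.

Definition filler (u v : X n.+1) (h : cancels u v) : X n.+2 := sval (cid (cancels_fill h)).

Lemma fillerP (u v : X n.+1) (h : cancels u v) :
  [/\ src (filler h) = comp_cell (cancels_comp h), tgt (filler h) = id_cell (src u)
    & pasted (filler h)].
Proof. exact: svalP (cid (cancels_fill h)). Qed.

Definition loop_base l := match l with Low c _ => c | Loop u _ _ _ => Cell (src u) end.
Definition loop_there l := match l with Low c _ => c | Loop u _ _ _ => Cell u end.
Definition loop_back l := match l with Low c _ => c | Loop _ v _ _ => Cell v end.
Definition loop_fill l :=
  match l with Low c _ => c | Loop _ _ h _ => Cell (filler h) end.
Definition loop_comp l : cell (L X) :=
  match l with
  | Low c _ => cell_map (eta L X) c
  | Loop _ _ h _ => Cell (pair_cell (comp_shape (cancels_comp h)))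
  end.
Definition loop_id l : cell (L X) :=
  match l with
  | Low c _ => cell_map (eta L X) c
  | Loop u _ _ _ => Cell (pair_cell (id_shape (src u)))
  end.

Lemma dim_loop_comp l : dim (loop_comp l) <= n.+1.
Proof. by case: l => [c hc|u v h1 h2] /=; [apply: leq_trans hc _|]. Qed.

Lemma dim_loop_id l : dim (loop_id l) <= n.+1.
Proof. by case: l => [c hc|u v h1 h2] /=; [apply: leq_trans hc _|]. Qed.

Lemma src_loop_comp l : csrc n (loop_comp l) = cell_map (eta L X) (loop_base l).
Proof.
case: l => [c hc|u v h1 h2] /=; first by rewrite csrc_id.
by rewrite csrc_Cell; case: (pair_binary (comp_shape (cancels_comp h1))) => ->.
Qed.

Lemma tgt_loop_comp l : ctgt n (loop_comp l) = cell_map (eta L X) (loop_base l).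
Proof.
case: l => [c hc|u v h1 h2] /=; first by rewrite ctgt_id.
rewrite ctgt_Cell; case: (pair_binary (comp_shape (cancels_comp h1))) => _ ->.
by rewrite (cancels_tgt h1).
Qed.

Lemma src_loop_id l : csrc n (loop_id l) = cell_map (eta L X) (loop_base l).
Proof.
case: l => [c hc|u v h1 h2] /=; first by rewrite csrc_id.
by rewrite csrc_Cell; case: (pair_single (id_shape (src u))) => ->.
Qed.

Lemma tgt_loop_id l : ctgt n (loop_id l) = cell_map (eta L X) (loop_base l).
Proof.
case: l => [c hc|u v h1 h2] /=; first by rewrite ctgt_id.
by rewrite ctgt_Cell; case: (pair_single (id_shape (src u))) => _ ->.
Qed.

Lemma in_tops_fill (E : Type) (F : E -> cell X) D (c : cell X) :
  List.In c (tops (fill (gid X) F D)) -> exists e, F e = c.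
Proof.
case: D => e0 es; case=> [<-|]; first by exists e0.
by rewrite /unzip2 /=; elim: es => [|[a e] es IH] //= [<-|/IH//]; exists e.
Qed.

Lemma join_cells (E : Type) (F : E -> cell X) (G : E -> table X) D :
  (forall e, G e = (F e, [::])) ->
  join (G D.1, [seq (p.1, G p.2) | p <- D.2]) = fill (gid X) F D.
Proof.
move=> eG; case: D => e0 es; rewrite /join eG /fill /=; congr pair.
by elim: es => [|[a e] es IH] //=; rewrite eG /= IH cell_map_id.
Qed.

Variable D : loop * seq (cell X * loop).
Hypothesis loD : low_seps n D.

(** The composite of the diagrams of all [u] and of all [v] is linked to an
    evaluation [c1] of the diagram of all [u * v], then by the cancelling cells to an
    evaluation [c2] of the diagram of identities, then to the identity on the
    source. *)
Lemma fill_cancels (w w' : L X n.+1) : src w = tgt w' -> tgt w = src w' ->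
    tab (ar L X n.+1 w) = fill (gid X) loop_there D ->
    tab (ar L X n.+1 w') = fill (gid X) loop_back D ->
  cancels (str X n.+1 w) (str X n.+1 w').
Proof.
move=> sww' tww' arw arw'; set x := src w.
have e : tgt (str X n.+1 w) = src (str X n.+1 w') by rewrite -gmap_tgt tww' gmap_src.
have base_there : table_src n (fill (gid X) loop_there D) = fill (gid X) loop_base D.
  rewrite fill_src //; apply: fill_ext => // -[c hc|u v h1 h2] /=; first exact: csrc_id.
  exact: csrc_Cell.
have arx : tab (ar L X n x) = fill (gid X) loop_base D by rewrite gmap_src /= arw.
have lB : linked (fill (gid X) loop_base D).1 (fill (gid X) loop_base D).2.
  by rewrite -arx; apply: tab_linked.
have exists_over (F : loop -> cell (L X)) : (forall l, dim (F l) <= n.+1) ->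
    (forall l, csrc n (F l) = cell_map (eta L X) (loop_base l)) ->
    (forall l, ctgt n (F l) = cell_map (eta L X) (loop_base l)) ->
    exists c, over x x (fill (gid X) (fun l => cell_map (str X) (F l)) D) c.
  move=> dF sF tF.
  have sF' l : csrc n (cell_map (str X) (F l)) = loop_base l.
    by rewrite csrc_map sF str_eta_cell.
  have tF' l : ctgt n (cell_map (str X) (F l)) = loop_base l.
    by rewrite ctgt_map tF str_eta_cell.
  apply: over_exists.
  - exact: parallel_refl.
  - by apply: (fill_linked loD lB) => l; rewrite sF' cell_map_id.
  - exact: fill_dim_le.
  - by rewrite arx fill_src //; apply: fill_ext.
  - by rewrite arx fill_tgt //; apply: fill_ext.
have [c1 O1] := exists_over _ dim_loop_comp src_loop_comp tgt_loop_comp.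
have [c2 O2] := exists_over _ dim_loop_id src_loop_id tgt_loop_id.
have lc1 : linkable (comp_cell e) c1.
  have := over_fill loD dim_loop_comp src_loop_comp tgt_loop_comp lB lB O1.
  apply: over_linkable.
  have -> : join (arity_table (loop_comp D.1),
       [seq (p.1, arity_table (loop_comp p.2)) | p <- D.2]) =
      table_comp n (tab (ar L X n.+1 w)) (tab (ar L X n.+1 w')).
    rewrite arw arw' fill_comp //.
    have el l : arity_table (loop_comp l) = block_comp n (loop_there l, [::]) (loop_back l, [::]).
      case: l => [c hc|u v h1 h2]; first by rewrite arity_eta /block_comp /= -/(dim c) hc.
      rewrite block_comp_cat //= /arity_table /inner /= ar_pair /= csrc_Cell.
      by rewrite (cancels_comp h1).
    by rewrite el; congr (join (_, _)); apply: eq_map => p; rewrite el.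
  by apply: over_comp; [exists w|exists w'].
have lc2 : linkable c2 (id_cell (src (str X n.+1 w))).
  have := over_fill loD dim_loop_id src_loop_id tgt_loop_id lB lB O2.
  move/over_linkable; apply; rewrite -gmap_src.
  have := over_id x; rewrite arx; congr (over _ _ _ _).
  rewrite [join _](@join_cells _ loop_base (fun l => arity_table (loop_id l))) //.
  case=> [c hc|u v h1 h2]; first by rewrite arity_eta.
  by rewrite /arity_table /inner /= ar_pair.
have l12 : linkable c1 c2.
  have sp l : csrc n.+1 (loop_fill l) = cell_map (str X) (loop_comp l).
    case: l => [c hc|u v h1 h2] /=; first by rewrite csrc_id ?str_eta_cell // leqW.
    by rewrite csrc_Cell; case: (fillerP h1) => ->.
  have tp l : ctgt n.+1 (loop_fill l) = cell_map (str X) (loop_id l).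
    case: l => [c hc|u v h1 h2] /=; first by rewrite ctgt_id ?str_eta_cell // leqW.
    by rewrite ctgt_Cell; case: (fillerP h1) => _ ->.
  have lo1 := low_sepsW (leqnSn n) loD.
  case: O1 => w1 [s1 t1 arw1 <-]; case: O2 => w2 [s2 t2 arw2 <-].
  have lP : linked (fill (gid X) loop_fill D).1 (fill (gid X) loop_fill D).2.
    apply: (fill_linked loD lB) => l; rewrite cell_map_id -(csrc_csrc _ (leqnSn n)) sp.
    by rewrite csrc_map src_loop_comp str_eta_cell.
  have dP : dim_le n.+2 (fill (gid X) loop_fill D).
    by apply: fill_dim_le => -[c hc|u v h1 h2] //=; rewrite ltnW // ltnW.
  apply: (@linkable_pasting L X n.+1 w1 w2 (@Pasting X n.+2 _ lP dP)).
  - by split; rewrite ?s1 ?s2 ?t1 ?t2.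
  - by apply: pasting_inj; rewrite arw1 /= fill_src //; apply: fill_ext.
  - by apply: pasting_inj; rewrite arw2 /= fill_tgt //; apply: fill_ext.
  - move=> z /in_tops_fill[[c hc|u v h1 h2]] /= ez.
      by move: hc; rewrite ez /dim /= => hc; lia.
    by move/Cell_inj: ez => <-; case: (fillerP h1).
by exists e; apply: linkable_trans lc1 (linkable_trans l12 lc2).
Qed.

End Loops.

(** The other cancellation is [fill_cancels] for the swapped loops. *)
Lemma fill_inverse n (D : loop n * seq (cell X * loop n)) (w : L X n.+1) :
    low_seps n D -> tab (ar L X n.+1 w) = fill (gid X) (@loop_there n) D ->
  has_inverse (str X n.+1 w).
Proof.
move=> loD arw.
have sU : table_src n (fill (gid X) (@loop_there n) D) =
    table_tgt n (fill (gid X) (@loop_back n) D).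
  rewrite fill_src // fill_tgt //; apply: fill_ext => // -[c hc|u v h1 h2] /=.
    by rewrite csrc_id // ctgt_id.
  by rewrite csrc_Cell ctgt_Cell (cancels_tgt h1).
have tU : table_tgt n (fill (gid X) (@loop_there n) D) =
    table_src n (fill (gid X) (@loop_back n) D).
  rewrite fill_src // fill_tgt //; apply: fill_ext => // -[c hc|u v h1 h2] /=.
    by rewrite csrc_id // ctgt_id.
  by rewrite csrc_Cell ctgt_Cell (cancels_tgt h2).
have lV : linked (fill (gid X) (@loop_back n) D).1 (fill (gid X) (@loop_back n) D).2.
  apply: (fill_linked (s := fun l => ctgt n (loop_there l)) loD) => [|l].
    by rewrite -fill_tgt // -arw; apply: linked_tgt; apply: tab_linked.
  case: l => [c hc|u v h1 h2] /=; rewrite cell_map_id; first by rewrite csrc_id // ctgt_id.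
  by rewrite csrc_Cell ctgt_Cell (cancels_comp h1).
have dV : dim_le n.+1 (fill (gid X) (@loop_back n) D).
  by apply: fill_dim_le => -[c hc|u v h1 h2] //=; apply: leq_trans hc _.
have [|||w' [sw' tw' arw']] := contraction_lift (x := tgt w) (y := src w)
    (D := @Pasting X n.+1 (fill (gid X) (@loop_back n) D) lV dV).
- exact: parallel_sym (parallel_src_tgt w).
- by apply: pasting_inj; rewrite gmap_tgt /= arw tU.
- by apply: pasting_inj; rewrite gmap_src /= arw sU.
have {}arw' : tab (ar L X n.+1 w') = fill (gid X) (@loop_back n) D by rewrite arw'.
exists (str X n.+1 w'); split; first by apply: (fill_cancels loD).
pose D' := (loop_swap D.1, [seq (p.1, loop_swap p.2) | p <- D.2]).
have eD (F G : loop n -> cell X) : (forall l, F (loop_swap l) = G l) ->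
    fill (gid X) F D' = fill (gid X) G D.
  move=> e; rewrite /fill /D' /= e -map_comp; congr pair.
  by apply: eq_map => p /=; rewrite e.
apply: (@fill_cancels n D') => //.
- by rewrite /low_seps /D' /= all_map.
- by rewrite arw'; apply/esym; apply: eD; case.
- by rewrite arw; apply/esym; apply: eD; case.
Qed.

End Fillings.

(** * Closure under pasting and the core *)

Section Closure.
Variables (L : contraction_monad) (X : algebra L).

(** A block together with an instruction evaluating it.  Its source and target in [L X]
    are units, so [over_fill] applies to a table of such blocks. *)
Record collapsed_block n := CollapsedBlock {
  col : cell (L X);
  col_src : cell X;
  col_tgt : cell X;
  col_dim : dim col <= n.+1;
  col_srcE : csrc n col = cell_map (eta L X) col_src;
  col_tgtE : ctgt n col = cell_map (eta L X) col_tgt;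
  col_inverse : forall x : X n.+1, cell_map (str X) col = Cell x -> has_inverse x }.

Definition collapsed_table n (h : collapsed_block n) : table X := arity_table (col h).

Lemma In_cat (A : Type) (x : A) s t : List.In x (s ++ t) <-> List.In x s \/ List.In x t.
Proof. by elim: s => [|y s IH] /=; [split=> [|[]]; [right| |]|rewrite IH; tauto]. Qed.

(** A chain gets an instruction from the contraction, between the units on
    its end points. *)
Lemma block_collapse n (B : table X) :
    linked B.1 B.2 -> is_block n B -> dim_le n.+1 B ->
    (forall x : X n.+1, List.In (Cell x) (tops B) -> has_inverse x) ->
  exists h : collapsed_block n, collapsed_table h = B.
Proof.
move=> lB bB dB hB; have [le_Bn|lt_nB] := leqP (dim B.1) n.
  have B2 := block_single le_Bn lB bB; rewrite (surjective_pairing B) B2.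
  set u := B.1 in le_Bn *.
  have dh : dim (cell_map (eta L X) u) <= n.+1 by apply: leqW.
  have sh : csrc n (cell_map (eta L X) u) = cell_map (eta L X) u by rewrite csrc_id.
  have th : ctgt n (cell_map (eta L X) u) = cell_map (eta L X) u by rewrite ctgt_id.
  have hh (x : X n.+1) : cell_map (str X) (cell_map (eta L X) u) = Cell x -> has_inverse x.
    by rewrite str_eta_cell => eu; move: le_Bn; rewrite eu /dim /= ltnn.
  by exists (CollapsedBlock dh sh th hh); rewrite /collapsed_table arity_eta.
pose P : T X n.+1 := Pasting lB dB.
have sB := block_src bB.
have [x ex] : exists x : X n, csrc n B.1 = Cell x.
  by apply: cell_of_dim; rewrite dim_csrc; lia.
have [y ey] : exists y : X n, ctgt n (last_entry B) = Cell y.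
  by apply: cell_of_dim; rewrite dim_ctgt; have := dim_last_entry lB bB lt_nB; lia.
have eP : src P = eta T X n x by apply: pasting_inj; rewrite /= sB ex.
have eP' : tgt P = eta T X n y.
  by apply: pasting_inj; rewrite /= /table_tgt blocks_id //= ey.
have par : parallel x y.
  have := parallel_src_tgt P; rewrite eP eP'.
  case: (n) x y {ex ey eP eP'} => [|m] x y //; rewrite /parallel -!gmap_src -!gmap_tgt.
  by move=> [/(congr1 (@tab _ _))[/Cell_inj -> ] /(congr1 (@tab _ _))[/Cell_inj ->]].
have [||h [sh th arh]] := contraction_lift (D := P) (parallel_map (eta L X) par).
- by rewrite ar_eta.
- by rewrite ar_eta.
have sh' : csrc n (Cell h) = cell_map (eta L X) (Cell x) by rewrite csrc_Cell sh.
have th' : ctgt n (Cell h) = cell_map (eta L X) (Cell y) by rewrite ctgt_Cell th.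
have hh (z : X n.+1) : cell_map (str X) (Cell h) = Cell z -> has_inverse z.
  move/Cell_inj => /= <-; case: B lB bB dB hB lt_nB @P {sB ex ey eP eP'} arh => u us.
  move=> lB bB dB hB lt_nB P arh.
  apply: (chain_inverse lB bB dB lt_nB hB (x := x) (y := y)).
  by exists h; rewrite arh.
exists (CollapsedBlock (leqnn _ : dim (Cell h) <= n.+1) sh' th' hh).
by rewrite /collapsed_table /arity_table /inner /= arh.
Qed.

Lemma blocks_collapse n B (Bs : seq (cell X * table X)) :
    linked_blocks B Bs -> is_blocks n B Bs -> dim_le n.+1 (join (B, Bs)) ->
    (forall x : X n.+1, List.In (Cell x) (tops (join (B, Bs))) -> has_inverse x) ->
  exists D : collapsed_block n * seq (cell X * collapsed_block n), low_seps n D /\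
    (B, Bs) = (collapsed_table D.1, [seq (p.1, collapsed_table p.2) | p <- D.2]).
Proof.
elim: Bs B => [|[a C] Bs IH] B lB bB dB hB.
  rewrite join_nil in dB hB; case/andP: bB => bB _.
  by have [h <-] := block_collapse lB bB dB hB; exists (h, [::]).
rewrite dim_le_join in dB; case/and3P: dB => dB dC dBs.
case: lB => lB [_ _ _ _ lC]; case/and3P: bB => bB /andP[/= lt_an bC] bBs.
have tE c : List.In c (tops (join (B, (a, C) :: Bs))) <->
    List.In c (tops B) \/ List.In c (tops (join (C, Bs))).
  rewrite (surjective_pairing B) join_cons /tops /= /unzip2 map_cat In_cat /=.
  tauto.
have [|h eh] := block_collapse lB bB dB; first by move=> x hx; apply: hB; apply/tE; left.
have [|||[h' hs] [lo [eC eBs]]] := IH C lC => //.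
- by apply/andP.
- by rewrite dim_le_join; apply/andP.
- by move=> x hx; apply: hB; apply/tE; right.
exists (h, (a, h') :: hs); split; first by rewrite /low_seps /= lt_an.
by rewrite /= eh eC eBs.
Qed.

(** Collapsing each block of the diagram to its composite yields a diagram with
    single-entry blocks, one evaluation of which is linkable to the given cell. *)
Lemma paste_inverse n (w : L X n.+1) :
    (forall x : X n.+1, List.In (Cell x) (tops (tab (ar L X n.+1 w))) -> has_inverse x) ->
  has_inverse (str X n.+1 w).
Proof.
set U := tab _ => hU; have lU : linked U.1 U.2 by apply: tab_linked.
have dU : dim_le n.+1 U by apply: tab_dim.
have eU : U = join (blocks n U.1 U.2) by rewrite join_blocks -surjective_pairing.
have [||||D [lo eB]] := @blocks_collapse n (blocks n U.1 U.2).1 (blocks n U.1 U.2).2.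
- exact: linked_blocksP.
- exact: blocks_is_blocks.
- by rewrite -surjective_pairing -eU.
- by rewrite -surjective_pairing -eU.
rewrite -surjective_pairing in eB.
have sB (h : collapsed_block n) : table_src n (collapsed_table h) = (col_src h, [::]).
  by rewrite -arity_src col_srcE arity_eta.
have tB (h : collapsed_block n) : table_tgt n (collapsed_table h) = (col_tgt h, [::]).
  by rewrite -arity_tgt col_tgtE arity_eta.
have bB h := proj1 (src_singleton (sB h)).
have sU : table_src n U = fill (gid X) (@col_src n) D.
  rewrite /table_src eB /= /fill -map_comp (proj2 (src_singleton (sB _))); congr pair.
  by apply: eq_map => p /=; rewrite cell_map_id (proj2 (src_singleton (sB _))).
have tU : table_tgt n U = fill (gid X) (@col_tgt n) D.
  rewrite /table_tgt eB /= /fill -map_comp (tgt_singleton (bB _) (tB _)); congr pair.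
  by apply: eq_map => p /=; rewrite cell_map_id (tgt_singleton (bB _) (tB _)).
have ls : linked (fill (gid X) (@col_src n) D).1 (fill (gid X) (@col_src n) D).2.
  by rewrite -sU; apply: linked_src.
have lt : linked (fill (gid X) (@col_tgt n) D).1 (fill (gid X) (@col_tgt n) D).2.
  by rewrite -tU; apply: linked_tgt.
pose F (h : collapsed_block n) : cell X := cell_map (str X) (col h).
have sF h : csrc n (F h) = col_src h by rewrite csrc_map col_srcE str_eta_cell.
have tF h : ctgt n (F h) = col_tgt h by rewrite ctgt_map col_tgtE str_eta_cell.
have [|||||d Od] := @over_exists L X n (src w) (tgt w) (fill (gid X) F D).
- exact: parallel_src_tgt.
- by apply: (fill_linked lo ls) => h; rewrite sF cell_map_id.
- by apply: fill_dim_le => h; apply: col_dim.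
- by rewrite fill_src // gmap_src /= -/U sU; apply: fill_ext.
- by rewrite fill_tgt // gmap_tgt /= -/U tU; apply: fill_ext.
have OU := over_fill lo (@col_dim n) (@col_srcE n) (@col_tgtE n) ls lt Od.
apply: (@inverse_linkable _ _ _ _ d).
  apply: over_linkable OU; exists w; split => //.
  by rewrite -/U eU eB.
have hl (h : collapsed_block n) : exists l : loop X n, loop_there l = F h.
  have [le_n|lt_n] := leqP (dim (F h)) n; first by exists (Low le_n).
  have [z ez] : exists z : X n.+1, F h = Cell z.
    by apply: cell_of_dim; apply/eqP; rewrite eqn_leq lt_n col_dim.
  by have [v [h1 h2]] := col_inverse ez; exists (Loop h1 h2).
pose g h := sval (cid (hl h)); have gE h : loop_there (g h) = F h := svalP (cid (hl h)).
case: Od => w' [_ _ arw' <-].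
apply: (@fill_inverse _ _ _ (g D.1, [seq (p.1, g p.2) | p <- D.2])).
  by rewrite /low_seps /= all_map.
rewrite arw' /fill /= gE -map_comp; congr pair.
by apply: eq_map => p /=; rewrite gE.
Qed.

Lemma invertible_Phi n (x : X n) : invertible x -> Phi (@invertible L X) x.
Proof.
case=> W [hW hx]; have sub m (y : X m) : W m y -> invertible y by exists W.
case: n x hx => [|n] x /hW //= [v [huv [hvu [p [q [[sp tp hp] [sq tq hq]]]]]]].
by exists v, huv, hvu, p, q; split; split=> //; apply: sub.
Qed.

Lemma pasted_Phi n (x : X n) : pasted x -> Phi (@pasted L X) x.
Proof.
elim=> {n x} [[|n] x /invertible_Phi //|n w _ IH].
  move=> [v [huv [hvu [p [q [[sp tp hp] [sq tq hq]]]]]]].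
  by exists v, huv, hvu, p, q; split; split=> //; apply: pasted_invertible.
by apply/PhiE; apply: paste_inverse => x /IH /PhiE.
Qed.

Lemma invertible_str n (w : L X n.+1) :
    (forall x : X n.+1, List.In (Cell x) (tops (tab (ar L X n.+1 w))) -> invertible x) ->
  invertible (str X n.+1 w).
Proof.
move=> h; exists (@pasted L X); split; first exact: pasted_Phi.
by apply: pasted_str => x /h; apply: pasted_invertible.
Qed.

Lemma tops_map (Y Z : globular_set) (f : gmap Y Z) (U : table Y) c :
  List.In c (tops (table_map f U)) -> exists2 b, List.In b (tops U) & c = cell_map f b.
Proof.
case: U => u us; case=> [<-|]; first by exists u => //; left.
rewrite /unzip2 /=; elim: us => [|[a v] us IH] //= [<-|/IH[b hb ->]].
  by exists v => //; right; left.
by exists b => //; case: hb => [->|hb]; [left|right; right].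
Qed.

Lemma hereditarily_invertible_str n (w : L (core X) n) :
  hereditarily_invertible (str X n (fmap L (core_incl X) n w)).
Proof.
elim: n w => [|n IH] w //=; split; last 2 first.
- by rewrite -!gmap_src; apply: IH.
- by rewrite -!gmap_tgt; apply: IH.
apply: invertible_str => x; rewrite ar_fmap => /tops_map[[k [y hy]] _] /= e.
have ek : k = n.+1 := esym (congr1 (@dim X) e).
by subst k; move/Cell_inj: e => ->; case: hy.
Qed.

Definition core_str_fun n (w : L (core X) n) : core X n :=
  exist _ (str X n (fmap L (core_incl X) n w)) (hereditarily_invertible_str w).

Lemma core_str_src n (w : L (core X) n.+1) : core_str_fun (src w) = src (core_str_fun w).
Proof. by apply: eq_exist; rewrite /= !gmap_src. Qed.

Lemma core_str_tgt n (w : L (core X) n.+1) : core_str_fun (tgt w) = tgt (core_str_fun w).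
Proof. by apply: eq_exist; rewrite /= !gmap_tgt. Qed.

Definition core_str : gmap (L (core X)) (core X) :=
  @Gmap (L (core X)) (core X) core_str_fun core_str_src core_str_tgt.

Lemma core_incl_inj n (x y : core X n) : core_incl X n x = core_incl X n y -> x = y.
Proof. by case: x y => x hx [y hy] /= e; apply: eq_exist. Qed.

Lemma core_str_is_algebra : is_algebra core_str.
Proof.
split=> [n x|n w]; apply: core_incl_inj => /=.
  by rewrite (eta_nat (cm_is_monad L)) eta_str.
rewrite (mu_nat (cm_is_monad L)) str_mu -!(fmap_comp (cm_is_monad L)).
by congr (str X n (fmap L _ n w)); apply: gmap_ext.
Qed.

Definition core_functor : strict_functor (Algebra core_str_is_algebra) X :=
  @StrictFunctor L (Algebra core_str_is_algebra) X (core_incl X) (fun _ _ => erefl).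

End Closure.

Theorem proposition3p4p1
    (L : contraction_monad) (hL : is_initial L) (X : algebra L) :
  (forall (n : nat) (w : L (core X) n),
     hereditarily_invertible (str X n (fmap L (core_incl X) n w)))
  /\
  (exists (xi : gmap (L (core X)) (core X)) (hxi : is_algebra xi)
          (i : strict_functor (Algebra hxi) X),
     (forall (n : nat) (x : core X n), i n x = core_incl X n x) /\ is_monic i).
Proof.
split; first exact: hereditarily_invertible_str.
exists (core_str X), (core_str_is_algebra X), (core_functor X); split => //.
by move=> C g h e n x; apply: core_incl_inj; apply: e.
Qed.
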